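(* (1) There is a terminating algorithm that takes as input any finite set of integers $1\le M_1<\cdots<M_n$ and gives as output a finite labeled directed graph $\mathcal{G}=(G,\mathcal{L})$ with a marked starting vertex $v_0$, which is a presentation of a path set $X=X(1,M_1,\ldots,M_n)$ describing the $3$-adic expansions of the elements of $$\mathcal{C}(1,M_1,\ldots,M_n)=\Sigma_3\cap\tfrac{1}{M_1}\Sigma_3\cap\cdots\cap\tfrac{1}{M_n}\Sigma_3,$$ that is, the set of sequences $(a_0,a_1,a_2,\ldots)$ that are label sequences of infinite walks in $\mathcal{G}$ starting at $v_0$ is exactly the set of digit sequences of elements $\sum_{j\ge 0}a_j3^j\in\mathcal{C}(1,M_1,\ldots,M_n)$. This presentation is right-resolving and all its vertices are reachable from the marked vertex $v_0$. The graph $G$ has at most $\prod_{i=1}^n\left(1+\lfloor\frac12 M_i\rfloor\right)$ vertices. (2) The topological entropy of the path set $X$ is $\log\beta$, where $\beta$ is the Perron eigenvalue of the adjacency matrix of the directed graph $G$. The number $\beta$ is a real algebraic integer satisfying $1\le\beta\le 2$. Furthermore, $$\dim_H(\mathcal{C}(1,M_1,\ldots,M_n))=\log_3\beta,$$ and this dimension lies in the interval $[0,\log_3 2]$.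
   Context: $\mathbb{Z}_3$ denotes the $3$-adic integers with the $3$-adic metric ($|3|_3=1/3$), and $\dim_H$ is Hausdorff dimension with respect to it. $\Sigma_3=\Sigma_{3,\bar 2}\subset\mathbb{Z}_3$ is the $3$-adic Cantor set: all $\sum_{j\ge0}a_j3^j$ with every $a_j\in\{0,1\}$. For an integer $M\ge1$, $\frac1M\Sigma_3\cap\Sigma_3=\{\lambda\in\Sigma_3: M\lambda\in\Sigma_3\}$; so $\mathcal{C}(1,M_1,\ldots,M_n)$ is the set of $\lambda\in\Sigma_3$ with $M_i\lambda\in\Sigma_3$ for all $i$. A labeled directed graph $\mathcal{G}=(G,\mathcal{L})$ is a finite directed graph $G$ (loops and multiple edges allowed) with each edge carrying a label from the alphabet $\{0,1,2\}$, no two edges having the same source, target and label. Given a marked vertex $v$, the associated path set is the set of all infinite sequences $(x_0,x_1,\ldots)$ of successive labels of infinite directed walks in $\mathcal{G}$ starting at $v$; $(\mathcal{G},v)$ is then called a presentation of that path set. It is right-resolving if for each vertex the outgoing edges have distinct labels. The adjacency matrix of $G$ has $(i,j)$ entry the number of edges from vertex $i$ to vertex $j$; its Perron eigenvalue is its largest real eigenvalue (equal to its spectral radius). The topological entropy of a path set $X$ is $\limsup_{n\to\infty}\frac1n\log N_n(X)$, where $N_n(X)$ is the number of distinct blocks of $n$ consecutive symbols appearing in elements of $X$. *)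

(* Defs.v *)
From HB Require Import structures.
From mathcomp Require Import all_boot all_order all_algebra.
From mathcomp Require Import all_classical all_reals all_analysis.

Set Implicit Arguments.
Unset Strict Implicit.
Unset Printing Implicit Defensive.

Import Order.TTheory GRing.Theory Num.Theory.
Import numFieldNormedType.Exports.

Local Open Scope classical_set_scope.
Local Open Scope ring_scope.

(** * Algorithms: partial recursive functions in the sense of Kleene *)

Inductive recfun : Type :=
| Zero
| Succ
| Proj of nat
| Comp of recfun & seq recfun
| Prec of recfun & recfun
| Mu of recfun.

(** [rec_eval f s y]: the computation of [f] on the argument list [s] terminates
    with value [y].  Arities are not recorded in the syntax: [Succ] and [Proj i]
    diverge on lists that are too short, and extra arguments are ignored. *)
Inductive rec_eval : recfun -> seq nat -> nat -> Prop :=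
| eval_Zero s : rec_eval Zero s 0
| eval_Succ x s : rec_eval Succ (x :: s) x.+1
| eval_Proj i s : (i < size s)%N -> rec_eval (Proj i) s (nth 0%N s i)
| eval_Comp f gs s ys y :
    rec_evals gs s ys -> rec_eval f ys y -> rec_eval (Comp f gs) s y
| eval_Prec0 f g s y : rec_eval f s y -> rec_eval (Prec f g) (0%N :: s) y
| eval_PrecS f g k s z y :
    rec_eval (Prec f g) (k :: s) z -> rec_eval g [:: k, z & s] y ->
    rec_eval (Prec f g) (k.+1 :: s) y
| eval_Mu f s k :
    rec_eval f (k :: s) 0 ->
    (forall j, (j < k)%N -> exists z, rec_eval f (j :: s) z.+1) ->
    rec_eval (Mu f) s k
with rec_evals : seq recfun -> seq nat -> seq nat -> Prop :=
| evals_nil s : rec_evals [::] s [::]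
| evals_cons g gs s y ys :
    rec_eval g s y -> rec_evals gs s ys -> rec_evals (g :: gs) s (y :: ys).

Fixpoint rec_eval_det (f : recfun) :
  forall s y y', rec_eval f s y -> rec_eval f s y' -> y = y'.
Proof.
case: f => [||i|f gs|f g|f] s y y'.
- by move=> e e'; inversion e; inversion e'.
- by move=> e e'; inversion e; subst; inversion e'.
- by move=> e e'; inversion e; inversion e'.
- have det_gs : forall t u u', rec_evals gs t u -> rec_evals gs t u' -> u = u'.
    elim: gs => [|g gs IH] t u u' e e'; inversion e; subst; inversion e'; subst.
      by [].
    by congr cons; [apply: (rec_eval_det g); eassumption | apply: IH; eassumption].
  move=> e e'; inversion e as [| | |? ? ? ys ? e1 e2| | |]; subst.
  inversion e' as [| | |? ? ? ys' ? e1' e2'| | |]; subst.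
  have E := det_gs _ _ _ e1 e1'; subst.
  exact: rec_eval_det e2 e2'.
- case: s => [|k s] e e'; first by inversion e.
  elim: k y y' e e' => [|k IH] y y' e e'; inversion e; subst;
    inversion e'; subst.
    by apply: (rec_eval_det f); eassumption.
  match goal with
  | H1 : rec_eval (Prec f g) (k :: s) ?a, H2 : rec_eval (Prec f g) (k :: s) ?b |- _ =>
      have E := IH _ _ H1 H2; subst
  end.
  by apply: (rec_eval_det g); eassumption.
- move=> e e'; inversion e as [| | | | | |? ? ? e0 lt_e]; subst.
  inversion e' as [| | | | | |? ? ? e0' lt_e']; subst.
  case: (ltngtP y y') => // [/lt_e'|/lt_e] [z ez].
    by have := rec_eval_det _ _ _ _ e0 ez.
  by have := rec_eval_det _ _ _ _ e0' ez.
Qed.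

(** * Labeled directed graphs and path sets *)

(** The vertices are [0, ..., n-1]; [(i, j, l)] is an edge from [i] to [j] with
    label [l], so that no two edges share source, target and label. *)
Definition lgraph (n : nat) := {set 'I_n * 'I_n * 'I_3}.

(** Infinite sequences of symbols of the alphabet [{0, 1, 2}]. *)
Definition symbols := nat -> 'I_3.

Section LabeledGraph.
Variables (n : nat) (G : lgraph n).

Definition path_set (v : 'I_n) : set symbols :=
  [set x | exists w : nat -> 'I_n,
     w 0%N = v /\ forall k, (w k, w k.+1, x k) \in G].

Definition right_resolving : Prop :=
  forall (i j j' : 'I_n) (l : 'I_3),
    (i, j, l) \in G -> (i, j', l) \in G -> j = j'.

Definition all_reachable (v : 'I_n) : Prop :=
  forall i, connect (fun j k => [exists l, (j, k, l) \in G]) v i.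

Definition adjacency (R : nzRingType) : 'M[R]_n :=
  \matrix_(i, j) #|[pred l | (i, j, l) \in G]|%:R.

(** [c] is the code of a list [[:: n, v & es]] where [es] lists the edges of [G],
    in any order; [CodeSeq.code] is the bijection of MathComp from [seq nat] to
    [nat]. *)
Definition edge_code (e : 'I_n * 'I_n * 'I_3) : nat :=
  CodeSeq.code [:: val e.1.1; val e.1.2; val e.2].

Definition encodes_graph (v : 'I_n) (c : nat) : Prop :=
  exists2 es : seq ('I_n * 'I_n * 'I_3),
    es =i G & c = CodeSeq.code [:: n, val v & map edge_code es].

End LabeledGraph.

Definition perron_eigenvalue (R : realType) (n : nat) (A : 'M[R]_n) (b : R) :
  Prop := eigenvalue A b /\ forall a, eigenvalue A a -> a <= b.

Definition nb_blocks (X : set symbols) (k : nat) : nat :=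
  #|[pred w : k.-tuple 'I_3 |
      `[< exists x m, X x /\ forall i : 'I_k, tnth w i = x (m + i)%N >]]|.

Definition topological_entropy (R : realType) (X : set symbols) : \bar R :=
  limn_esup (fun k => ((k%:R^-1)%:E * lne (nb_blocks X k)%:R%:E)%E).

(** * Hausdorff dimension *)

Section Hausdorff.
Variables (R : realType) (T : metricType R).
Implicit Type A : set T.

Definition diam A : \bar R :=
  maxe 0%E (ereal_sup [set (mdist xy.1 xy.2)%:E | xy in A `*` A]).

Definition hausdorff_premeasure (s d : R) A : \bar R :=
  ereal_inf [set (\sum_(0 <= i <oo) poweR (diam (U i)) s)%E | U in
    [set U : nat -> set T | A `<=` \bigcup_i U i /\
                            forall i, (diam (U i) <= d%:E)%E]].

Definition hausdorff_measure (s : R) A : \bar R :=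
  ereal_sup [set hausdorff_premeasure s d A | d in [set d | 0 < d]].

(** Only exponents [s > 0] are used, so that the value of [0 `^ 0] plays no
    role; the infimum is the same as over [s >= 0]. *)
Definition hausdorff_dim A : \bar R :=
  ereal_inf [set s%:E | s in [set s | 0 < s /\ hausdorff_measure s A = 0%E]].

End Hausdorff.

(** * The 3-adic integers *)

(** Inverse limit of the rings of integers modulo [3 ^ n]: [res n] is the residue
    modulo [3 ^ n], as a natural number smaller than [3 ^ n]. *)
Record Z3 : Type := MkZ3 {
  res :> nat -> nat;
  resP : forall n, res n = (res n.+1 %% 3 ^ n)%N }.

Lemma Z3_ext (x y : Z3) : (forall n, x n = y n) -> x = y.
Proof.
case: x y => [x xP] [y yP] /= /funext E; rewrite E in xP *.
by congr MkZ3; exact: Prop_irrelevance.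
Qed.

Lemma res_mod (x : Z3) n : (x n %% 3 ^ n)%N = x n.
Proof. by rewrite [x n]resP modn_mod. Qed.

Lemma res_lt (x : Z3) n : (x n < 3 ^ n)%N.
Proof. by rewrite -res_mod ltn_pmod// expn_gt0. Qed.

Lemma res_le (x : Z3) m n : (m <= n)%N -> x m = (x n %% 3 ^ m)%N.
Proof.
move=> /subnKC <-; elim: (n - m)%N => [|k IH]; first by rewrite addn0 res_mod.
by rewrite IH (resP _ (m + k)) addnS modn_dvdm// dvdn_exp2l// leq_addr.
Qed.

(** The 3-adic integer with residues [f n] modulo [3 ^ n]. *)
Definition Z3_of (f : nat -> nat) (fP : forall n, f n.+1 = f n %[mod 3 ^ n]) : Z3.
Proof.
apply: (@MkZ3 (fun n => f n %% 3 ^ n)%N) => n.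
by rewrite modn_dvdm ?fP// dvdn_exp2l.
Defined.

HB.instance Definition _ := gen_eqMixin Z3.
HB.instance Definition _ := gen_choiceMixin Z3.

Lemma res_succ (x : Z3) n : x n.+1 = x n %[mod 3 ^ n].
Proof. by rewrite [x n]resP modn_mod. Qed.

Fact Z3_add_subproof (x y : Z3) n : (x n.+1 + y n.+1 = x n + y n %[mod 3 ^ n])%N.
Proof. by rewrite -modnDm !res_succ modnDm. Qed.
Definition Z3_add x y := Z3_of (Z3_add_subproof x y).

Fact Z3_mul_subproof (x y : Z3) n : (x n.+1 * y n.+1 = x n * y n %[mod 3 ^ n])%N.
Proof. by rewrite -modnMm !res_succ modnMm. Qed.
Definition Z3_mul x y := Z3_of (Z3_mul_subproof x y).

Fact Z3_opp_subproof (x : Z3) n :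
  (3 ^ n.+1 - x n.+1 = 3 ^ n - x n %[mod 3 ^ n])%N.
Proof.
apply/eqP; rewrite -(eqn_modDr (x n.+1)) subnK ?(ltnW (res_lt _ _))//.
rewrite -modnDmr res_succ modnDmr subnK ?(ltnW (res_lt _ _))//.
by rewrite expnS modnMl modnn.
Qed.
Definition Z3_opp x := Z3_of (Z3_opp_subproof x).

Definition Z3_zero := Z3_of (fun n => erefl (0 %% 3 ^ n)%N).
Definition Z3_one := Z3_of (fun n => erefl (1 %% 3 ^ n)%N).

Fact Z3_addA : associative Z3_add.
Proof. by move=> x y z; apply: Z3_ext => n /=; rewrite modnDmr modnDml addnA. Qed.
Fact Z3_addC : commutative Z3_add.
Proof. by move=> x y; apply: Z3_ext => n /=; rewrite addnC. Qed.
Fact Z3_add0 : left_id Z3_zero Z3_add.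
Proof. by move=> x; apply: Z3_ext => n /=; rewrite modnDml add0n res_mod. Qed.
Fact Z3_addN : left_inverse Z3_zero Z3_opp Z3_add.
Proof.
move=> x; apply: Z3_ext => n /=.
by rewrite modnDml subnK ?(ltnW (res_lt _ _))// modnn mod0n.
Qed.

HB.instance Definition _ :=
  GRing.isZmodule.Build Z3 Z3_addA Z3_addC Z3_add0 Z3_addN.

Fact Z3_mulA : associative Z3_mul.
Proof. by move=> x y z; apply: Z3_ext => n /=; rewrite modnMmr modnMml mulnA. Qed.
Fact Z3_mulC : commutative Z3_mul.
Proof. by move=> x y; apply: Z3_ext => n /=; rewrite mulnC. Qed.
Fact Z3_mul1 : left_id Z3_one Z3_mul.
Proof. by move=> x; apply: Z3_ext => n /=; rewrite modnMml mul1n res_mod. Qed.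
Fact Z3_mulD : left_distributive Z3_mul Z3_add.
Proof.
by move=> x y z; apply: Z3_ext => n /=; rewrite modnMml modnDm mulnDl.
Qed.
Fact Z3_one_neq0 : Z3_one != Z3_zero.
Proof. by apply/eqP => /(congr1 (fun x : Z3 => x 1%N)). Qed.

HB.instance Definition _ := GRing.Zmodule_isComNzRing.Build Z3
  Z3_mulA Z3_mulC Z3_mul1 Z3_mulD Z3_one_neq0.

Lemma resD (x y : Z3) n : (x + y) n = ((x n + y n) %% 3 ^ n)%N.
Proof. by []. Qed.

Lemma resM (x y : Z3) n : (x * y) n = ((x n * y n) %% 3 ^ n)%N.
Proof. by []. Qed.

Lemma resN (x : Z3) n : (- x) n = ((3 ^ n - x n) %% 3 ^ n)%N.
Proof. by []. Qed.

Lemma res0 n : (0 : Z3) n = 0%N.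
Proof. exact: mod0n. Qed.

Lemma res_nat k n : (k%:R : Z3) n = (k %% 3 ^ n)%N.
Proof.
elim: k => [|k IH]; first by rewrite res0 mod0n.
by rewrite -natr1 resD IH (_ : (1 : Z3) n = (1 %% 3 ^ n)%N)// modnDm addn1.
Qed.

(** ** The 3-adic absolute value and metric *)

(** [|x| = inf {3 ^ - n : 3 ^ n divides x}] *)
Definition Z3_norm (R : realType) (x : Z3) : R :=
  inf [set 3%:R ^- n | n in [set n | x n = 0%N]].

Section Z3Norm.
Variable R : realType.
Local Notation norm := (Z3_norm R).

Lemma Z3_norm_has_inf (x : Z3) :
  has_inf [set (3%:R : R) ^- n | n in [set n | x n = 0%N]].
Proof.
split; first by exists (3%:R ^- 0), 0%N => //=; rewrite resP expn0 modn1.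
by exists 0 => _ [n _ <-]; rewrite invr_ge0 exprn_ge0.
Qed.

Lemma Z3_norm_ge0 (x : Z3) : 0 <= norm x.
Proof.
apply: lb_le_inf; first exact: (Z3_norm_has_inf x).1.
by move=> _ [n _ <-]; rewrite invr_ge0 exprn_ge0.
Qed.

Lemma Z3_norm_le (x : Z3) n : (norm x <= 3%:R ^- n) = (x n == 0%N).
Proof.
apply/idP/eqP => [le_x|xn]; last first.
  by apply: ge_inf; [exact: (Z3_norm_has_inf x).2 | exists n].
have : norm x < 3%:R ^- n * 3%:R.
  by rewrite (le_lt_trans le_x)// ltr_pMr ?ltr1n// invr_gt0 exprn_gt0.
move=> /(inf_lt (Z3_norm_has_inf x).1) [_ [m xm <-]].
rewrite -ltr_pdivrMr// -invfM -exprSr ltf_pV2 ?posrE ?exprn_gt0//.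
rewrite ltr_eXn2l ?ltr1n// ltnS => le_nm.
by rewrite (res_le _ le_nm) xm mod0n.
Qed.

Lemma Z3_norm0 : norm 0 = 0.
Proof.
apply/eqP; rewrite eq_le Z3_norm_ge0 andbT leNgt; apply/negP => nx.
have [n] : exists n, (2%:R : R) ^- n < norm 0.
  have [n _ /(_ n (leqnn n)) /= +] := near_infty_natSinv_expn_lt (PosNum nx).
  by exists n; rewrite -div1r.
apply/negP; rewrite -leNgt (@le_trans _ _ (3%:R ^- n))//.
  by rewrite Z3_norm_le res0.
by rewrite lef_pV2 ?posrE ?exprn_gt0// lerXn2r ?nnegrE// ler_nat.
Qed.

Lemma Z3_norm_eq0 (x : Z3) : norm x = 0 -> x = 0.
Proof.
move=> x0; apply: Z3_ext => n; rewrite res0; apply/eqP.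
by rewrite -Z3_norm_le x0 invr_ge0 exprn_ge0.
Qed.

Lemma Z3_normN (x : Z3) : norm (- x) = norm x.
Proof.
suff H (y : Z3) n : y n = 0%N -> (- y) n = 0%N.
  rewrite /Z3_norm; congr (inf (_ @` _)); apply/seteqP; split=> n /= xn.
    by have := H (- x) n xn; rewrite opprK.
  exact: H.
by move=> yn; rewrite resN yn subn0 modnn.
Qed.

Lemma Z3_normD (x y : Z3) : norm (x + y) <= norm x + norm y.
Proof.
rewrite -lerBlDr; apply: lb_le_inf; first exact: (Z3_norm_has_inf x).1.
move=> _ [n xn <-]; rewrite lerBlDr -lerBlDl.
apply: lb_le_inf; first exact: (Z3_norm_has_inf y).1.
move=> _ [m ym <-]; rewrite lerBlDl.
have h k : (k <= n)%N -> (k <= m)%N -> norm (x + y) <= 3%:R ^- k.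
  by move=> kn km; rewrite Z3_norm_le resD (res_le _ kn) (res_le _ km) xn ym !mod0n.
have [nm|/ltnW mn] := leqP n m.
  by rewrite (le_trans (h _ (leqnn n) nm))// lerDl invr_ge0 exprn_ge0.
by rewrite (le_trans (h _ mn (leqnn m)))// lerDr invr_ge0 exprn_ge0.
Qed.

End Z3Norm.

(** The 3-adic integers with the metric taking its values in [R]; the topology
    cannot be attached to [Z3] itself, whose type does not mention [R]. *)
Definition Z3_metric (R : realType) : Type := Z3.

HB.instance Definition _ (R : realType) := Choice.on (Z3_metric R).

Definition Z3_dist (R : realType) (x y : Z3_metric R) : R :=
  Z3_norm R ((x : Z3) - (y : Z3)).

Section Z3Metric.
Variable R : realType.

Fact Z3_distxx (x : Z3_metric R) : Z3_dist x x = 0.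
Proof. by rewrite /Z3_dist subrr Z3_norm0. Qed.

Fact Z3_dist_positivity (x y : Z3_metric R) : Z3_dist x y = 0 -> x = y.
Proof. by move=> /Z3_norm_eq0/subr0_eq. Qed.

Fact Z3_dist_sym (x y : Z3_metric R) : Z3_dist x y = Z3_dist y x.
Proof. by rewrite /Z3_dist -Z3_normN opprB. Qed.

Fact Z3_dist_triangle (y x z : Z3_metric R) :
  Z3_dist x z <= Z3_dist x y + Z3_dist y z.
Proof.
rewrite /Z3_dist (_ : (x : Z3) - z = ((x : Z3) - y) + ((y : Z3) - z)).
  exact: Z3_normD.
by rewrite addrA subrK.
Qed.

HB.instance Definition _ := isMetric.Build R (Z3_metric R)
  Z3_distxx Z3_dist_positivity Z3_dist_sym Z3_dist_triangle.

End Z3Metric.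

Definition hausdorff_dim_Z3 (R : realType) (A : set Z3) : \bar R :=
  hausdorff_dim (A : set (Z3_metric R)).

(** ** Digit expansions and the 3-adic Cantor set *)

Fact Z3_digits_subproof (a : symbols) n :
  (\sum_(j < n.+1) a j * 3 ^ j = \sum_(j < n) a j * 3 ^ j %[mod 3 ^ n])%N.
Proof. by rewrite big_ord_recr /= addnC modnMDl. Qed.

(** The 3-adic integer with digits [a], that is the sum of the series of general
    term [a j * 3 ^ j]; see [Z3_digits_cvg]. *)
Definition Z3_digits (a : symbols) : Z3 := Z3_of (Z3_digits_subproof a).

Lemma Z3_digits_cvg (R : realType) (a : symbols) :
  ((\sum_(j < n) (a j)%:R * 3%:R ^+ j : Z3) : Z3_metric R) @[n --> \oo]
    --> (Z3_digits a : Z3_metric R).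
Proof.
have partial m n : (m <= n)%N ->
    (\sum_(j < n) (a j)%:R * 3%:R ^+ j : Z3) m = Z3_digits a m.
  move=> mn; under eq_bigr do rewrite -natrX -natrM.
  rewrite -natr_sum res_nat; move: mn => /subnKC <-.
  elim: (n - m)%N => [|k IH]; first by rewrite addn0.
  by rewrite addnS big_ord_recr /= -modnDmr expnD mulnCA modnMr addn0.
apply/cvg_ballP => e e0.
have [m _ /(_ m (leqnn m)) /= me] := near_infty_natSinv_expn_lt (PosNum e0).
exists m => // n /= mn; rewrite ballEmdist /= (le_lt_trans _ me)// div1r.
rewrite (@le_trans _ _ (3%:R ^- m))//.
  by rewrite Z3_norm_le resD resN partial// modnDmr subnKC ?modnn// ltnW// res_lt.
by rewrite lef_pV2 ?posrE ?exprn_gt0// lerXn2r ?nnegrE// ler_nat.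
Qed.

Definition Sigma3 : set Z3 :=
  [set Z3_digits a | a in [set a : symbols | forall j, (a j < 2)%N]].

(** [cantor_inter M] is [C(1, M_1, ..., M_n)] for [M = [:: M_1; ...; M_n]]. *)
Definition cantor_inter (M : seq nat) : set Z3 :=
  [set x | Sigma3 x /\ forall m, m \in M -> Sigma3 (m%:R * x)].

(* Main.v *)
Require Import Defs.
From mathcomp Require Import all_boot all_order all_algebra.
From mathcomp Require Import all_classical all_reals all_analysis.
From mathcomp Require Import polyrcf zify ring lra.

(** After [k] digits, which form a natural number [x < 3 ^ k], what remains of the
    past in the multiplication by the [M_i] are the carries [M_i * x %/ 3 ^ k].  When
    the digits are 0 and 1, [2 * x < 3 ^ k], so that the carries are at most
    [M_i %/ 2]: the attainable vectors of carries are the vertices of the graph, and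
    each of them is attained with fewer than [\prod_i (1 + M_i %/ 2)] digits.

    Let [beta] be the largest real eigenvalue of the adjacency matrix [A].  For
    [t > beta] the equation [t x = A x + 1] has a positive solution, hence there are
    [O(t ^ k)] blocks of length [k]; covering by the cylinders of these blocks bounds
    the dimension by the entropy.  Conversely the absolute values [y] of an
    eigenvector satisfy [A y >= beta y], so that the weight [y_i / beta ^ k] of the
    cylinder of a walk of length [k] to [i] is at most the sum of the weights of the
    cylinders that subdivide it.  Given a cover of small cost, one can thus choose the
    digits one by one and build a point that is not covered; this bounds the dimension
    from below, and closes the chain of inequalities. *)

Set Implicit Arguments.
Unset Strict Implicit.
Unset Printing Implicit Defensive.

Import Order.TTheory GRing.Theory Num.Theory.
Import numFieldNormedType.Exports.
Local Open Scope classical_set_scope.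
Local Open Scope nat_scope.

Local Notation code := CodeSeq.code.
Local Notation decode := CodeSeq.decode.

(** * Computable functions of lists of natural numbers *)

(** The value is prescribed only on lists of length [k], because [rec_eval] may diverge on shorter
    ones. Boolean functions are covered through their coercion to [nat]. *)
Definition computable (k : nat) (f : seq nat -> nat) : Prop :=
  exists r, forall s, size s = k -> rec_eval r s (f s).

Lemma eq_computable k f g :
  (forall s, size s = k -> f s = g s) -> computable k f -> computable k g.
Proof. by move=> fg [r rP]; exists r => s sk; rewrite -fg//; exact: rP. Qed.

Lemma computable_var k i : i < k -> computable k (fun s => nth 0 s i).
Proof. by move=> ik; exists (Proj i) => s sk; constructor; rewrite sk. Qed.

Lemma computable_drop k m i : m + i < k ->
  computable k (fun s => nth 0 (drop m s) i).
Proof.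
by move=> /computable_var; apply: eq_computable => s _; rewrite nth_drop.
Qed.

Lemma computable_comp k l g (fs : seq (seq nat -> nat)) :
  computable l g -> size fs = l ->
  (forall i, i < l -> computable k (nth (fun=> 0) fs i)) ->
  computable k (fun s => g [seq f s | f <- fs]).
Proof.
move=> [r rP] fsl fsP.
suff [rs rsP] : exists rs, forall s, size s = k ->
    rec_evals rs s [seq f s | f <- fs].
  exists (Comp r rs) => s sk; apply: eval_Comp; first exact: rsP.
  by apply: rP; rewrite size_map.
rewrite -{}fsl in fsP; elim: fs fsP => [|f fs IH] fsP.
  by exists [::] => s _; constructor.
have [q qP] := fsP 0 isT.
have [//|rs rsP] := IH; first by move=> i; exact: (fsP i.+1).
by exists (q :: rs) => s sk /=; constructor; [exact: qP | exact: rsP].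
Qed.

(** This lemma and its variants with more arguments replace the arguments by variables. A body with
    bounded iterations is then treated in a short context, with few nested binders. *)
Lemma computable_app1 g k f : computable 1 (fun s => g (nth 0 s 0)) ->
  computable k f -> computable k (fun s => g (f s)).
Proof.
move=> gP fP.
by apply: (computable_comp (fs := [:: f]) gP) => // -[].
Qed.

Lemma computable_app2 g k f0 f1 :
  computable 2 (fun s => g (nth 0 s 0) (nth 0 s 1)) ->
  computable k f0 -> computable k f1 -> computable k (fun s => g (f0 s) (f1 s)).
Proof.
move=> gP f0P f1P.
by apply: (computable_comp (fs := [:: f0; f1]) gP) => // -[|[]].
Qed.

Lemma computable_app3 g k f0 f1 f2 :
  computable 3 (fun s => g (nth 0 s 0) (nth 0 s 1) (nth 0 s 2)) ->
  computable k f0 -> computable k f1 -> computable k f2 ->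
  computable k (fun s => g (f0 s) (f1 s) (f2 s)).
Proof.
move=> gP f0P f1P f2P.
by apply: (computable_comp (fs := [:: f0; f1; f2]) gP) => // -[|[|[]]].
Qed.

Lemma computable_app4 g k f0 f1 f2 f3 :
  computable 4 (fun s => g (nth 0 s 0) (nth 0 s 1) (nth 0 s 2) (nth 0 s 3)) ->
  computable k f0 -> computable k f1 -> computable k f2 -> computable k f3 ->
  computable k (fun s => g (f0 s) (f1 s) (f2 s) (f3 s)).
Proof.
move=> gP f0P f1P f2P f3P.
by apply: (computable_comp (fs := [:: f0; f1; f2; f3]) gP) => // -[|[|[|[]]]].
Qed.

(* Under a binder the list of arguments is extended with the index and the
   accumulator; the former arguments are [drop 2 s]. *)
Lemma computable_iteri k n E b :
  computable k.+2 (fun s => E (drop 2 s) (nth 0 s 0) (nth 0 s 1)) ->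
  computable k n -> computable k b ->
  computable k (fun s => iteri (n s) (E s) (b s)).
Proof.
move=> [re reP] [rn rnP] [rb rbP].
exists (Comp (Prec rb re) (rn :: [seq Proj i | i <- iota 0 k])) => s sk.
have : rec_evals [seq Proj i | i <- iota 0 k] s s.
  rewrite -[s in X in rec_evals _ _ X](mkseq_nth 0) /mkseq sk.
  have : all (fun i => i < size s) (iota 0 k).
    by rewrite sk; apply/allP => i; rewrite mem_iota.
  elim: (iota 0 k) => [|i t IH] /=; first by constructor.
  by case/andP=> ik ?; constructor; [exact: eval_Proj | exact: IH].
move=> evs; apply: eval_Comp; first by constructor; [exact: rnP | exact: evs].
elim: (n s) => [|m IH] /=; first by constructor; exact: rbP.
apply: eval_PrecS; first exact: IH.
by have := reP [:: m, iteri m (E s) (b s) & s]; rewrite /= drop0 sk; apply.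
Qed.

Lemma computable_succ k f : computable k f -> computable k (fun s => (f s).+1).
Proof.
apply: (computable_app1 (g := succn)).
by exists Succ => -[|x [|y s]]//= _; constructor.
Qed.

Lemma computable_const k c : computable k (fun=> c).
Proof.
elim: c => [|c]; first by exists Zero => s _; constructor.
exact: computable_succ.
Qed.

Lemma computable_drop2 k m l i : m + l + i < k ->
  computable k (fun s => nth 0 (drop m (drop l s)) i).
Proof.
by move=> /computable_drop; apply: eq_computable => s _; rewrite drop_drop.
Qed.

Create HintDb computable.
#[local] Hint Resolve computable_const computable_succ computable_iteri : computable.
#[local] Hint Extern 1 (is_true (_ < _)) => exact isT : computable.
#[local] Hint Resolve computable_var computable_drop computable_drop2 : computable.

Ltac computable := auto 60 with computable.

Lemma computable_addn k f g : computable k f -> computable k g ->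
  computable k (fun s => f s + g s).
Proof.
move=> fP gP.
apply: (eq_computable (f := fun s => iteri (g s) (fun _ z => z.+1) (f s))).
  by move=> s _; elim: (g s) => [|n /= ->]; rewrite ?addn0 ?addnS.
computable.
Qed.
#[local] Hint Resolve computable_addn : computable.

Lemma computable_muln k f g : computable k f -> computable k g ->
  computable k (fun s => f s * g s).
Proof.
apply: computable_app2.
apply: (eq_computable (f := fun s =>
  iteri (nth 0 s 1) (fun _ z => nth 0 s 0 + z) 0)); last by computable.
by move=> s _; elim: (nth 0 s 1) => [|n /= ->]; rewrite ?muln0 ?mulnS.
Qed.
#[local] Hint Resolve computable_muln : computable.

Lemma computable_expn k f g : computable k f -> computable k g ->
  computable k (fun s => f s ^ g s).
Proof.
apply: computable_app2.
apply: (eq_computable (f := fun s =>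
  iteri (nth 0 s 1) (fun _ z => nth 0 s 0 * z) 1)); last by computable.
by move=> s _; elim: (nth 0 s 1) => [|n /= ->]; rewrite ?expn0 ?expnS.
Qed.
#[local] Hint Resolve computable_expn : computable.

Lemma computable_subn k f g : computable k f -> computable k g ->
  computable k (fun s => f s - g s).
Proof.
apply: computable_app2.
have pred_comp l h : computable l h -> computable l (fun s => (h s).-1).
  apply: (computable_app1 (g := predn)).
  (* The last index visited by the iteration is the predecessor; with no iteration the result is
     0. *)
  apply: (eq_computable (f := fun s => iteri (nth 0 s 0) (fun i _ => i) 0)).
    by move=> s _; case: (nth 0 s 0).
  by computable.
apply: (eq_computable (f := fun s =>
  iteri (nth 0 s 1) (fun _ z => z.-1) (nth 0 s 0))); last by computable.
by move=> s _; elim: (nth 0 s 1) => [|n /= ->]; rewrite ?subn0 ?subnS.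
Qed.
#[local] Hint Resolve computable_subn : computable.

Lemma computable_if k (b : seq nat -> bool) f g :
  computable k b -> computable k f -> computable k g ->
  computable k (fun s => if b s then f s else g s).
Proof.
move=> bP fP gP.
apply: (eq_computable (f := fun s => b s * f s + (1 - b s) * g s)).
  by move=> s _; case: (b s); rewrite ?mul1n ?mul0n ?addn0.
by computable.
Qed.
#[local] Hint Resolve computable_if : computable.

Lemma computable_leq k f g : computable k f -> computable k g ->
  computable k (fun s => f s <= g s).
Proof.
move=> fP gP.
apply: (eq_computable (f := fun s => 1 - (f s - g s))); last by computable.
by move=> s _; rewrite /leq; case: (f s - g s).
Qed.
#[local] Hint Resolve computable_leq : computable.

Lemma computable_andb k (b c : seq nat -> bool) :
  computable k b -> computable k c -> computable k (fun s => b s && c s).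
Proof.
move=> bP cP.
apply: (eq_computable (f := fun s => b s * c s)); last by computable.
by move=> s _; case: (b s); rewrite ?mul1n.
Qed.
#[local] Hint Resolve computable_andb : computable.

Lemma computable_negb k (b : seq nat -> bool) :
  computable k b -> computable k (fun s => ~~ b s).
Proof.
move=> bP; apply: (eq_computable (f := fun s => 1 - b s)); last by computable.
by move=> s _; case: (b s).
Qed.
#[local] Hint Resolve computable_negb : computable.

Lemma computable_eqn k f g : computable k f -> computable k g ->
  computable k (fun s => f s == g s).
Proof.
move=> fP gP.
apply: (eq_computable (f := fun s => (f s <= g s) && (g s <= f s))).
  by move=> s _; rewrite eqn_leq.
by computable.
Qed.
#[local] Hint Resolve computable_eqn : computable.

Lemma iota0S m : iota 0 m.+1 = rcons (iota 0 m) m.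
Proof. by rewrite -addn1 iotaD cats1. Qed.

Lemma computable_all k (P : seq nat -> nat -> bool) n :
  computable k.+2 (fun s => P (drop 2 s) (nth 0 s 0)) -> computable k n ->
  computable k (fun s => all (P s) (iota 0 (n s))).
Proof.
move=> PP nP.
apply: (eq_computable
  (f := fun s => iteri (n s) (fun i z => (z == 1) && P s i) 1)); last by computable.
move=> s _; elim: (n s) => [//|m].
by rewrite iota0S all_rcons andbC /= => ->; rewrite eqb1.
Qed.
#[local] Hint Resolve computable_all : computable.

Lemma computable_count k (P : seq nat -> nat -> bool) n :
  computable k.+2 (fun s => P (drop 2 s) (nth 0 s 0)) -> computable k n ->
  computable k (fun s => count (P s) (iota 0 (n s))).
Proof.
move=> PP nP.
apply: (eq_computable (f := fun s => iteri (n s) (fun i z => z + P s i) 0));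
  last by computable.
move=> s _; elim: (n s) => [//|m].
by rewrite iota0S -cats1 count_cat /= => ->; rewrite addn0.
Qed.
#[local] Hint Resolve computable_count : computable.

Lemma computable_find k (P : seq nat -> nat -> bool) n :
  computable k.+2 (fun s => P (drop 2 s) (nth 0 s 0)) -> computable k n ->
  computable k (fun s => find (P s) (iota 0 (n s))).
Proof.
move=> PP nP.
(* The test [i <= z] says that no success has occurred before [i]; after the first success [z] is
   frozen. *)
apply: (eq_computable (f := fun s => iteri (n s)
  (fun i z => if (i <= z) && ~~ P s i then z.+1 else z) 0)); last by computable.
move=> s _; elim: (n s) => [//|m IH].
rewrite iota0S -cats1 find_cat size_iota /= IH.
have -> : (m <= find (P s) (iota 0 m)) = ~~ has (P s) (iota 0 m).
  by rewrite has_find size_iota -leqNgt.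
have [//|nhas] := boolP (has (P s) (iota 0 m)).
by rewrite hasNfind// size_iota; case: (P s m); rewrite /= ?addn0 ?addn1.
Qed.
#[local] Hint Resolve computable_find : computable.

Lemma computable_prod k F n :
  computable k.+2 (fun s => F (drop 2 s) (nth 0 s 0)) -> computable k n ->
  computable k (fun s => \prod_(0 <= i < n s) F s i).
Proof.
move=> FP nP.
apply: (eq_computable (f := fun s => iteri (n s) (fun i z => F s i * z) 1));
  last by computable.
move=> s _; elim: (n s) => [|m /= ->]; first by rewrite big_nil.
by rewrite big_nat_recr//= mulnC.
Qed.
#[local] Hint Resolve computable_prod : computable.

Lemma computable_divn k f g : computable k f -> computable k g ->
  computable k (fun s => f s %/ g s).
Proof.
apply: computable_app2.
(* The quotient counts the positive multiples of the divisor up to the dividend. A zero divisor is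
   set apart: its quotient is 0 by convention, whereas every [q] would be counted. *)
apply: (eq_computable (f := fun s => if nth 0 s 1 == 0 then 0 else
  count (fun q => q.+1 * nth 0 s 1 <= nth 0 s 0) (iota 0 (nth 0 s 0))));
  last by computable.
move=> s _; move: (nth 0 s 0) (nth 0 s 1) => x y.
have [->|y0] := eqVneq y 0; first by rewrite divn0.
rewrite -lt0n in y0; transitivity (minn (x %/ y) x); last first.
  exact/minn_idPl/leq_div.
under eq_count do rewrite -leq_divRL//.
elim: {2 4}x => [|m IH]; first by rewrite minn0.
by rewrite iota0S -cats1 count_cat {}IH /=; move: (x %/ y) => q; lia.
Qed.
#[local] Hint Resolve computable_divn : computable.

Lemma computable_modn k f g : computable k f -> computable k g ->
  computable k (fun s => f s %% g s).
Proof.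
move=> fP gP.
apply: (eq_computable (f := fun s => f s - f s %/ g s * g s)).
  by move=> s _; rewrite {1}(divn_eq (f s) (g s)) addKn.
apply: computable_subn => //; apply: computable_muln => //.
exact: computable_divn.
Qed.

#[local] Hint Resolve computable_modn : computable.

(** * Computations on codes of lists *)

Lemma computable_code_cons k f g : computable k f -> computable k g ->
  computable k (fun s => code (f s :: decode (g s))).
Proof.
move=> fP gP.
apply: (eq_computable (f := fun s => 2 ^ f s * (2 * g s).+1)); last by computable.
by move=> s _ /=; rewrite CodeSeq.decodeK mul2n.
Qed.
#[local] Hint Resolve computable_code_cons : computable.

(** The list with head x and a tail of code c has code 2^x (2c + 1): the head is the position of the
    lowest binary digit 1, and the tail is read above that digit. *)
Definition code_head c := find (fun h => (c %/ 2 ^ h) %% 2 == 1) (iota 0 c).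
Definition code_behead c := c %/ 2 ^ code_head c %/ 2.

Lemma code_head_cons x s : code_head (code (x :: s)) = x.
Proof.
rewrite /code_head /=; set c := code s.
have c0 : x < 2 ^ x * c.*2.+1.
  by rewrite (leq_trans (ltn_expl x (isT : 1 < 2)))// leq_pmulr.
have xP : (2 ^ x * c.*2.+1 %/ 2 ^ x) %% 2 == 1.
  by rewrite mulKn ?expn_gt0// modn2 /= odd_double.
have -> : iota 0 (2 ^ x * c.*2.+1) =
    iota 0 x ++ x :: iota x.+1 (2 ^ x * c.*2.+1 - x.+1).
  by rewrite -[RHS](iotaD 0 x (_ - x.+1).+1) addnS -addSn subnKC.
rewrite find_cat size_iota ifN /= ?xP ?addn0//.
apply/hasPn => h; rewrite mem_iota add0n /= => hx.
have -> : 2 ^ x * c.*2.+1 = 2 * (2 ^ (x - h.+1) * c.*2.+1) * 2 ^ h.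
  by rewrite -{1}(subnK hx) expnD expnS; lia.
by rewrite mulnK ?expn_gt0// modnMr.
Qed.

Lemma code_behead_cons x s : code_behead (code (x :: s)) = code s.
Proof.
rewrite /code_behead code_head_cons /= mulKn ?expn_gt0//.
by rewrite -muln2 -addn1 divnMDl// addn0.
Qed.

Lemma computable_code_head k f : computable k f ->
  computable k (fun s => code_head (f s)).
Proof. by apply: computable_app1; rewrite /code_head; computable. Qed.
#[local] Hint Resolve computable_code_head : computable.

Lemma computable_code_behead k f : computable k f ->
  computable k (fun s => code_behead (f s)).
Proof. by apply: computable_app1; rewrite /code_behead; computable. Qed.
#[local] Hint Resolve computable_code_behead : computable.

Lemma iter_code_behead i c : iteri i (fun _ => code_behead) c = code (drop i (decode c)).
Proof.
rewrite -{1}[c]CodeSeq.decodeK; elim: i (decode c) => [|i IH] s.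
  by rewrite drop0.
rewrite [LHS]/= IH; have [si|si] := leqP (size s) i.
  by rewrite !drop_oversize// ltnW.
by rewrite (drop_nth 0 si) code_behead_cons.
Qed.

Lemma computable_nth k f g : computable k f -> computable k g ->
  computable k (fun s => nth 0 (decode (f s)) (g s)).
Proof.
move=> fP gP.
apply: (eq_computable (f := fun s =>
  code_head (iteri (g s) (fun _ => code_behead) (f s)))); last by computable.
move=> s _; rewrite iter_code_behead -[g s in RHS]addn0 -nth_drop.
(* Past the end the remaining code is 0, and [code_head] sends it to 0, the default value of
   [nth]. *)
by case: drop => [|x t]//; rewrite code_head_cons.
Qed.
#[local] Hint Resolve computable_nth : computable.

Lemma size_decode c : size (decode c) <= c.
Proof.
rewrite -{2}[c]CodeSeq.decodeK; elim: (decode c) => //= x s IH.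
rewrite (@leq_trans (code s).*2.+1)// ?leq_pmull ?expn_gt0//.
by rewrite ltnS (leq_trans IH)// -addnn leq_addr.
Qed.

Lemma computable_size k f : computable k f ->
  computable k (fun s => size (decode (f s))).
Proof.
apply: (computable_app1 (g := fun c => size (decode c))).
(* The empty list alone has code 0, so the length is the number of iterated tails with nonzero code;
   by [size_decode] the code itself bounds the search. *)
apply: (eq_computable (f := fun s => count (fun i =>
  iteri i (fun _ => code_behead) (nth 0 s 0) != 0) (iota 0 (nth 0 s 0))));
  last by computable.
move=> s _; move: (nth 0 s 0) => c; set t := decode c.
have -> : size t = minn (size t) c by apply/esym/minn_idPl/size_decode.
elim: {2 3}c => [|m]; first by rewrite minn0.
rewrite iota0S -cats1 count_cat /= iter_code_behead -/t.
have -> : (code (drop m t) != 0) = (m < size t).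
  rewrite -subn_gt0 -size_drop; case: drop => //= x u.
  by rewrite muln_eq0 negb_or expn_eq0.
by move: (size t) => u -> ; lia.
Qed.
#[local] Hint Resolve computable_size : computable.

(** Each new value is pushed at the head, whence the reversal. It is harmless for a list of edges,
    which [encodes_graph] accepts in any order. *)
Lemma computable_code_rev_mkseq k F n :
  computable k.+2 (fun s => F (drop 2 s) (nth 0 s 0)) -> computable k n ->
  computable k (fun s => code (rev (mkseq (F s) (n s)))).
Proof.
move=> FP nP.
apply: (eq_computable (f := fun s => iteri (n s)
  (fun i z => code (F s i :: decode z)) 0)); last by computable.
move=> s _; elim: (n s) => [//|m /= ->].
by rewrite CodeSeq.codeK /mkseq -/(iota 0 m.+1) iota0S map_rcons rev_rcons.
Qed.
#[local] Hint Resolve computable_code_rev_mkseq : computable.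

(** * Carries and vertices *)

Section Rank.
Variables (f : pred nat) (P : nat).

Definition rank p := count f (iota 0 p).
(** This is the inverse of [rank]: the elements of [f] below [P] are numbered in increasing order,
    by bounded searches so that the numbering is computable. *)
Definition select i := find (fun p => f p && (rank p == i)) (iota 0 P).

Lemma rank_ltn p q : f p -> p < q -> rank p < rank q.
Proof.
rewrite /rank => fp pq; rewrite -(subnKC pq) iotaD count_cat iota0S -cats1.
by rewrite count_cat [count f [:: p]]/= fp addn0 addn1 leq_addr.
Qed.

Lemma rank_inj p q : f p -> f q -> rank p = rank q -> p = q.
Proof.
move=> fp fq pq; case: (ltngtP p q) => // [/(rank_ltn fp)|/(rank_ltn fq)].
  by rewrite pq ltnn.
by rewrite pq ltnn.
Qed.

Lemma selectP i : i < rank P ->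
  [/\ select i < P, f (select i) & rank (select i) = i].
Proof.
move=> iP; have : has (fun p => f p && (rank p == i)) (iota 0 P).
  elim: P iP => [//|m IH]; rewrite {1}/rank !iota0S -cats1 count_cat has_cat.
  rewrite /= addn0 orbF; have [mi _|mi] := ltnP i (rank m); first by rewrite IH.
  case: (f m) => [|]/=; last by rewrite addn0 ltnNge mi.
  by rewrite addn1 ltnS => le_i; rewrite eqn_leq mi le_i orbT.
move=> hasP; have := nth_find 0 hasP; move: (hasP); rewrite has_find size_iota => ltP.
by rewrite nth_iota// add0n => /andP[? /eqP ?]; split.
Qed.

Lemma select_rank p : p < P -> f p -> select (rank p) = p.
Proof.
move=> pP fp; have [_ fs rs] := selectP (rank_ltn fp pP).
exact: rank_inj rs.
Qed.

End Rank.

(* [M] stands for [1 :: M]: the multiplier 1 expresses that the digits of [x] are 0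
   and 1; it produces no carry, and a factor 1 in the bound on the vertices. *)
Definition carry (M : seq nat) k x i := nth 0 M i * x %/ 3 ^ k.

(** Only the digits of index below [k] of the multiples are tested, since the later ones can still
    change when [x] receives more digits. *)
Definition admissible M k x :=
  (x < 3 ^ k) && all (fun i =>
     all (fun j => (nth 0 M i * x %/ 3 ^ j) %% 3 < 2) (iota 0 k))
  (iota 0 (size M)).

Definition same_carries M k x k' x' :=
  all (fun i => carry M k x i == carry M k' x' i) (iota 0 (size M)).

(** The residue modulo 3 is the digit of index [k] of M_i (x + a 3^k), and the quotient by 3 is the
    next carry. Both depend on [x] through its carries only. *)
Definition digit_ok M k x a :=
  all (fun i => (carry M k x i + nth 0 M i * a) %% 3 < 2) (iota 0 (size M)).

Definition transition M k x k' x' a := digit_ok M k x a &&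
  all (fun i => (carry M k x i + nth 0 M i * a) %/ 3 == carry M k' x' i)
    (iota 0 (size M)).

Section Carries.
Variable M : seq nat.

Definition carries k x := [seq m * x %/ 3 ^ k | m <- M].

Lemma carriesE k x : carries k x = mkseq (carry M k x) (size M).
Proof.
rewrite /carries -{1}[M](mkseq_nth 0) -map_comp.
by apply: eq_map => i.
Qed.

Lemma all_iotaP (Q : pred nat) n :
  reflect (forall i, i < n -> Q i) (all Q (iota 0 n)).
Proof.
apply: (iffP allP) => QP i; last by rewrite mem_iota => /QP.
by move=> ?; apply: QP; rewrite mem_iota.
Qed.

Lemma carries_eqP k x k' x' : carries k x = carries k' x' <->
  forall i, i < size M -> carry M k x i = carry M k' x' i.
Proof.
rewrite !carriesE; split => [E i iM|E].
  by have := congr1 (fun s => nth 0 s i) E; rewrite !nth_mkseq.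
by apply: (@eq_from_nth _ 0) => [|i]; rewrite !size_mkseq// => ?; rewrite !nth_mkseq// E.
Qed.

Lemma same_carriesP k x k' x' :
  reflect (carries k x = carries k' x') (same_carries M k x k' x').
Proof.
apply: (iffP (all_iotaP _ _)) => [E|/carries_eqP E i ?]; last exact/eqP/E.
by apply/carries_eqP => i /E /eqP.
Qed.

Lemma digit_ok_eq k x k' x' a : carries k x = carries k' x' ->
  digit_ok M k x a = digit_ok M k' x' a.
Proof.
move=> /carries_eqP E; apply: eq_in_all => i; rewrite mem_iota => iM.
by rewrite E.
Qed.

Lemma carry_next k x a i :
  carry M k.+1 (x + a * 3 ^ k) i = (carry M k x i + nth 0 M i * a) %/ 3.
Proof.
by rewrite /carry expnSr divnMA mulnDr mulnA divnDMl// expn_gt0.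
Qed.

Lemma transitionP k x k' x' a :
  reflect (digit_ok M k x a /\ carries k' x' = carries k.+1 (x + a * 3 ^ k))
    (transition M k x k' x' a).
Proof.
apply: (iffP andP) => -[ok].
  move=> /all_iotaP E; split=> //; apply/carries_eqP => i /E /eqP <-.
  by rewrite carry_next.
move=> /carries_eqP E; split=> //; apply/all_iotaP => i /E ->.
by rewrite carry_next.
Qed.

(** Adding a multiple of 3^k leaves the digits of index below [k] of each multiple unchanged; the
    digit of index [k] is the one tested by [digit_ok]. *)
Lemma admissibleS k x a : x < 3 ^ k -> a < 3 ->
  admissible M k.+1 (x + a * 3 ^ k) = admissible M k x && digit_ok M k x a.
Proof.
move=> xk a3; rewrite /admissible xk.
have -> : x + a * 3 ^ k < 3 ^ k.+1 by rewrite expnS; nia.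
rewrite !andTb /digit_ok -all_predI; apply: eq_in_all => i _.
rewrite iota0S all_rcons [RHS]/= andbC; congr andb; last first.
  by rewrite mulnDr mulnA divnDMl ?expn_gt0.
apply: eq_in_all => j; rewrite mem_iota add0n => /= jk.
rewrite mulnDr -{1}(subnK (ltnW jk)) expnD !mulnA divnDMl ?expn_gt0//.
by rewrite -(subnSK jk) expnS mulnCA -modnDmr modnMr addn0.
Qed.

Lemma admissibleW k z : admissible M k.+1 z -> exists x a,
  [/\ a < 3, z = x + a * 3 ^ k, admissible M k x & digit_ok M k x a].
Proof.
move=> zP; exists (z %% 3 ^ k), (z %/ 3 ^ k).
have z_lt : z < 3 ^ k.+1 by case/andP: zP.
have zE : z = z %% 3 ^ k + z %/ 3 ^ k * 3 ^ k by rewrite addnC -divn_eq.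
have q3 : z %/ 3 ^ k < 3 by rewrite ltn_divLR ?expn_gt0// -expnS.
by move: zP; rewrite {1}zE admissibleS// ?ltn_pmod ?expn_gt0// => /andP[].
Qed.

Lemma admissible0 : admissible M 0 0.
Proof. by rewrite /admissible /=; apply/all_iotaP. Qed.

Lemma admissible_ind (Q : nat -> nat -> Prop) : Q 0 0 ->
  (forall k x a, a < 3 -> admissible M k x -> digit_ok M k x a -> Q k x ->
     Q k.+1 (x + a * 3 ^ k)) ->
  forall k x, admissible M k x -> Q k x.
Proof.
move=> Q0 QS; elim=> [|k IH] z; last first.
  by move=> /admissibleW[x [a [a3 -> xP ok]]]; apply: QS => //; exact: IH.
by case/andP=> +_; rewrite ltnS leqn0 => /eqP ->.
Qed.

Lemma admissible_lt k x : admissible M k x -> x < 3 ^ k.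
Proof. by case/andP. Qed.

Lemma admissible_prefix k x j : j <= k -> admissible M k x ->
  admissible M j (x %% 3 ^ j).
Proof.
elim: k x => [|k IH] x; first by rewrite leqn0 => /eqP ->; rewrite modn1 admissible0.
rewrite leq_eqVlt => /predU1P[-> xP|]; first by rewrite modn_small// admissible_lt.
rewrite ltnS => jk /admissibleW[y [a [_ -> yP _]]].
rewrite -(subnK jk) expnD mulnA -modnDmr modnMl addn0; exact: IH.
Qed.

(** The future depends on the past through the carries only, so the first [j] digits can be
    exchanged for another word with the same carries. *)
Lemma admissible_splice i y j x d : admissible M i y ->
  admissible M (j + d) x -> carries i y = carries j (x %% 3 ^ j) ->
  exists2 x', admissible M (i + d) x' & carries (i + d) x' = carries (j + d) x.
Proof.
move=> yP; elim: d x => [|d IH] x.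
  rewrite !addn0 => xP E; exists y => //; rewrite E modn_small//.
  exact: admissible_lt xP.
rewrite !addnS => /admissibleW[z [a [a3 -> zP ok]]] E.
have [|x' x'P E'] := IH z zP.
  by rewrite E expnD mulnCA -modnDmr modnMr addn0.
exists (x' + a * 3 ^ (i + d)).
  by rewrite admissibleS ?(admissible_lt x'P)// x'P (digit_ok_eq _ E') ok.
apply/carries_eqP => l lM; rewrite !carry_next.
by move/carries_eqP: E' => ->.
Qed.

Definition nb_carries := \prod_(0 <= i < size M) (1 + nth 0 M i %/ 2).

Fixpoint carry_box (N : seq nat) : seq (seq nat) :=
  if N is m :: N' then [seq c :: s | c <- iota 0 (1 + m %/ 2), s <- carry_box N']
  else [:: [::]].

Lemma size_carry_box : size (carry_box M) = nb_carries.
Proof.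
rewrite /nb_carries -(big_nth 0 xpredT (fun m => 1 + m %/ 2)).
elim: M => [|m N IH]; first by rewrite big_nil.
by rewrite big_cons -IH -[X in X * _](size_iota 0) -(size_allpairs cons).
Qed.

Hypothesis M1 : 1 \in M.

Lemma digit_ok_lt2 k x a : x < 3 ^ k -> a < 3 -> digit_ok M k x a -> a < 2.
Proof.
move=> xk a3 /all_iotaP /(_ (index 1 M)).
by rewrite index_mem /carry nth_index// !mul1n divn_small// modn_small//; apply.
Qed.

Lemma admissible_half k x : admissible M k x -> 2 * x < 3 ^ k.
Proof.
elim/admissible_ind: k x / => // k x a a3 xP /digit_ok_lt2 a2 xk.
have {}a2 := a2 (admissible_lt xP) a3.
rewrite expnS; nia.
Qed.

Lemma carries_in_box k x : admissible M k x -> carries k x \in carry_box M.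
Proof.
move=> /admissible_half xk; rewrite /carries; elim: M => [//|m N IH].
apply: allpairs_f => //; rewrite mem_iota leq0n add0n add1n ltnS leq_divRL//.
have := leq_divM (m * x) (3 ^ k).
move: (m * x %/ 3 ^ k) (3 ^ k) xk => c B; nia.
Qed.

(** In a word of minimal length with the given carries, the prefixes have pairwise distinct carries:
    otherwise splicing would shorten it. Their number, one more than the length, is thus at most the
    size of the box. *)
Lemma admissible_short k x : admissible M k x ->
  exists k' x', [/\ k' < nb_carries, admissible M k' x' &
    carries k' x' = carries k x].
Proof.
move=> xP; pose Q j := `[< exists2 y, admissible M j y & carries j y = carries k x >].
have exQ : exists j, Q j by exists k; apply/asboolP; exists x.
case: (ex_minnP exQ) => j /asboolP[y yP yE] minj; exists j, y; split=> //.
rewrite -size_carry_box.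
have <- : size [seq carries i (y %% 3 ^ i) | i <- iota 0 j.+1] = j.+1.
  by rewrite size_map size_iota.
apply: uniq_leq_size; last first.
  move=> _ /mapP[i + ->]; rewrite mem_iota add0n ltnS => /= ij.
  by apply: carries_in_box; exact: admissible_prefix yP.
rewrite map_inj_in_uniq ?iota_uniq// => i1 i2.
rewrite !mem_iota !add0n !ltnS /= => i1j i2j E.
wlog lt12 : i1 i2 i1j i2j E / i1 < i2.
  by move=> H; case: (ltngtP i1 i2) => // lt; [exact: H | apply/esym/H].
have [] := @admissible_splice i1 (y %% 3 ^ i1) i2 y (j - i2) => //.
- exact: admissible_prefix yP.
- by rewrite subnKC.
move=> z zP; rewrite subnKC// yE => zE.
have /minj : Q (i1 + (j - i2)) by apply/asboolP; exists z.
lia.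
Qed.

End Carries.

(* The [k] digits forming [x], with [k < N := nb_carries M], are coded by the number
   [k * 3 ^ N + x]. *)
Definition vertex_bound M := nb_carries M * 3 ^ nb_carries M.

Definition admissible_code M p :=
  admissible M (p %/ 3 ^ nb_carries M) (p %% 3 ^ nb_carries M).

Definition same_carries_code M p q := same_carries M
  (p %/ 3 ^ nb_carries M) (p %% 3 ^ nb_carries M)
  (q %/ 3 ^ nb_carries M) (q %% 3 ^ nb_carries M).

(* [p] is the least code of its vector of carries. *)
Definition is_vertex M p := admissible_code M p &&
  all (fun q => ~~ (admissible_code M q && same_carries_code M q p)) (iota 0 p).

Definition nb_vertices M := rank (is_vertex M) (vertex_bound M).
Definition vertex M i := select (is_vertex M) (vertex_bound M) i.

Definition is_edge M i j a := transition M
  (vertex M i %/ 3 ^ nb_carries M) (vertex M i %% 3 ^ nb_carries M)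
  (vertex M j %/ 3 ^ nb_carries M) (vertex M j %% 3 ^ nb_carries M) a.

Section Vertices.
Variable M : seq nat.
Hypothesis M1 : 1 \in M.

Let N := nb_carries M.

Definition vertex_carries i :=
  carries M (vertex M i %/ 3 ^ N) (vertex M i %% 3 ^ N).

Lemma carries_vertex k x : admissible M k x ->
  exists2 i, i < nb_vertices M & vertex_carries i = carries M k x.
Proof.
move=> /(admissible_short M1)[k' [x' [k'N x'P <-]]].
have x'lt : x' < 3 ^ N.
  by rewrite (leq_trans (admissible_lt x'P))// leq_exp2l// ltnW.
(* The least code with the given carries is the required vertex; the code of the short word shows
   that it lies below [vertex_bound]. *)
pose Q p := admissible_code M p && (carries M (p %/ 3 ^ N) (p %% 3 ^ N) == carries M k' x').
have QP : Q (k' * 3 ^ N + x').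
  rewrite /Q /admissible_code -/N divnMDl ?expn_gt0// modnMDl divn_small// addn0.
  by rewrite (modn_small x'lt) x'P eqxx.
have exQ : exists p, Q p by exists (k' * 3 ^ N + x').
case: (ex_minnP exQ) => p /andP[pP /eqP pE] minp.
have p_lt : p < vertex_bound M.
  rewrite (leq_ltn_trans (minp _ QP))// /vertex_bound -/N.
  by move: (3 ^ N) x'lt k'N => B; rewrite -/N; nia.
have pV : is_vertex M p.
  rewrite /is_vertex pP; apply/all_iotaP => q qp; apply/negP => /andP[qP].
  move=> /same_carriesP qE.
  by have /minp := introT andP (conj qP (introT eqP (etrans qE pE))); rewrite leqNgt qp.
exists (rank (is_vertex M) p); first exact: rank_ltn.
by rewrite /vertex_carries /vertex select_rank// pE.
Qed.

Lemma vertexP i : i < nb_vertices M ->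
  admissible M (vertex M i %/ 3 ^ N) (vertex M i %% 3 ^ N).
Proof. by move=> /selectP[_ /andP[]]. Qed.

Lemma vertex_carries_inj i j : i < nb_vertices M -> j < nb_vertices M ->
  vertex_carries i = vertex_carries j -> i = j.
Proof.
move=> /selectP[_ Vi {2}<-] /selectP[_ Vj {2}<-] E; congr rank.
suff H p q : is_vertex M p -> is_vertex M q ->
    carries M (p %/ 3 ^ N) (p %% 3 ^ N) = carries M (q %/ 3 ^ N) (q %% 3 ^ N) ->
    p <= q.
  apply/eqP; rewrite eqn_leq; apply/andP; split; exact: H.
move=> /andP[_ /all_iotaP Vp] /andP[qP _] pq; rewrite leqNgt; apply/negP => /Vp.
by rewrite qP => /negP; apply; apply/same_carriesP.
Qed.

Lemma nb_vertices_leq : nb_vertices M <= N.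
Proof.
rewrite /N -size_carry_box -[nb_vertices M](size_iota 0) -(size_map vertex_carries).
apply: uniq_leq_size; last first.
  move=> _ /mapP[i + ->]; rewrite mem_iota => /= iV.
  exact/carries_in_box/vertexP.
rewrite map_inj_in_uniq ?iota_uniq// => i j; rewrite !mem_iota.
exact: vertex_carries_inj.
Qed.

(** The empty word has code 0, the least of all. Hence the vertex without carries has number 0,
    which [graph_code] writes as the marked vertex. *)
Lemma vertex0 : vertex M 0 = 0.
Proof.
have V0 : is_vertex M 0 by rewrite /is_vertex /admissible_code div0n mod0n admissible0.
rewrite /vertex -[X in select _ _ X]/(rank (is_vertex M) 0) select_rank//.
rewrite /vertex_bound muln_gt0 expn_gt0 andbT /nb_carries.
by apply: prodn_gt0.
Qed.

Lemma nb_vertices_gt0 : 0 < nb_vertices M.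
Proof. by have [i /(leq_ltn_trans (leq0n _))] := carries_vertex (admissible0 M). Qed.

End Vertices.

(** * The algorithm and the graph of carries *)

Lemma computable_admissible k f g h :
  computable k f -> computable k g -> computable k h ->
  computable k (fun s => admissible (decode (f s)) (g s) (h s)).
Proof.
by apply: (computable_app3 (g := fun c x y => admissible (decode c) x y));
  rewrite /admissible; computable.
Qed.
#[local] Hint Resolve computable_admissible : computable.

Lemma computable_nb_carries k f : computable k f ->
  computable k (fun s => nb_carries (decode (f s))).
Proof.
by apply: (computable_app1 (g := fun c => nb_carries (decode c)));
  rewrite /nb_carries; computable.
Qed.
#[local] Hint Resolve computable_nb_carries : computable.

Lemma computable_admissible_code k f g : computable k f -> computable k g ->
  computable k (fun s => admissible_code (decode (f s)) (g s)).
Proof. by rewrite /admissible_code; computable. Qed.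
#[local] Hint Resolve computable_admissible_code : computable.

Lemma computable_same_carries_code k f g h :
  computable k f -> computable k g -> computable k h ->
  computable k (fun s => same_carries_code (decode (f s)) (g s) (h s)).
Proof.
by apply: (computable_app3 (g := fun c x y => same_carries_code (decode c) x y));
  rewrite /same_carries_code /same_carries /carry; computable.
Qed.
#[local] Hint Resolve computable_same_carries_code : computable.

Lemma computable_is_vertex k f g : computable k f -> computable k g ->
  computable k (fun s => is_vertex (decode (f s)) (g s)).
Proof.
by apply: (computable_app2 (g := fun c x => is_vertex (decode c) x));
  rewrite /is_vertex; computable.
Qed.
#[local] Hint Resolve computable_is_vertex : computable.

Lemma computable_nb_vertices k f : computable k f ->
  computable k (fun s => nb_vertices (decode (f s))).
Proof.
by apply: (computable_app1 (g := fun c => nb_vertices (decode c)));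
  rewrite /nb_vertices /rank /vertex_bound; computable.
Qed.
#[local] Hint Resolve computable_nb_vertices : computable.

Lemma computable_vertex k f g : computable k f -> computable k g ->
  computable k (fun s => vertex (decode (f s)) (g s)).
Proof.
by apply: (computable_app2 (g := fun c x => vertex (decode c) x));
  rewrite /vertex /select /rank /vertex_bound; computable.
Qed.
#[local] Hint Resolve computable_vertex : computable.

Lemma computable_is_edge k f g h l :
  computable k f -> computable k g -> computable k h -> computable k l ->
  computable k (fun s => is_edge (decode (f s)) (g s) (h s) (l s)).
Proof.
by apply: (computable_app4 (g := fun c x y z => is_edge (decode c) x y z));
  rewrite /is_edge /transition /digit_ok /carry; computable.
Qed.
#[local] Hint Resolve computable_is_edge : computable.

(* The loop [(0, 0, 0)] stands for the triples that are not edges, [encodes_graph]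
   allowing repetitions.  The lists are written [x :: decode (code s)] in order to
   match [computable_code_cons]. *)
Definition edge_list_code M e :=
  let n := nb_vertices M in
  if is_edge M (e %/ 3 %/ n) (e %/ 3 %% n) (e %% 3)
  then code (e %/ 3 %/ n :: decode (code (e %/ 3 %% n :: decode (code (e %% 3 :: decode 0)))))
  else code (0 :: decode (code (0 :: decode (code (0 :: decode 0))))).

Definition graph_code M :=
  let n := nb_vertices M in
  code (n :: decode (code (0 :: decode
    (code (rev (mkseq (edge_list_code M) (n * n * 3))))))).

(** The input codes [M] while the graph is built from [1 :: M]; the algorithm first adds this
    multiplier. *)
Lemma computable_graph_code :
  computable 1 (fun s => graph_code (decode (code (1 :: decode (nth 0 s 0))))).
Proof.
apply: (computable_app1 (g := fun c => graph_code (decode c))); last by computable.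
have H k f g : computable k f -> computable k g ->
    computable k (fun s => edge_list_code (decode (f s)) (g s)).
  apply: (computable_app2 (g := fun c x => edge_list_code (decode c) x)).
  by rewrite /edge_list_code; computable.
by rewrite /graph_code; computable.
Qed.

Section Graph.
Variable M : seq nat.
Hypothesis M1 : 1 \in M.

Definition carry_graph : lgraph (nb_vertices M) :=
  [set e : 'I_(nb_vertices M) * 'I_(nb_vertices M) * 'I_3 | is_edge M e.1.1 e.1.2 e.2]%SET.

Definition vertex_origin : 'I_(nb_vertices M) := Ordinal (nb_vertices_gt0 M1).

Local Notation G := carry_graph.
Local Notation v0 := vertex_origin.
Local Notation vc i := (vertex_carries M i).

(** An edge can be tested on any word with the carries of its source, not only on the representative
    that defines the vertex. *)
Lemma carry_graphE (i j : 'I_(nb_vertices M)) (a : 'I_3) k x : vc i = carries M k x ->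
  ((i, j, a) \in G) =
    digit_ok M k x a && (vc j == carries M k.+1 (x + a * 3 ^ k)).
Proof.
move=> E; rewrite inE /= /is_edge; apply/transitionP/andP => -[ok E']; split.
- by rewrite -(digit_ok_eq _ E).
- apply/eqP; rewrite /vertex_carries E'; apply/carries_eqP => l lM.
  by rewrite !carry_next; move/carries_eqP: E => ->.
- by rewrite (digit_ok_eq _ E).
move/eqP: E' => E'; rewrite [LHS]E'; apply/carries_eqP => l lM.
by rewrite !carry_next; move/carries_eqP: E => ->.
Qed.

Lemma vertex_carries0 : vc v0 = carries M 0 0.
Proof.
rewrite /vertex_carries /= vertex0 div0n mod0n; apply/carries_eqP => i _.
by rewrite /carry muln0 !div0n.
Qed.

Lemma carries_vertexI k x : admissible M k x -> exists i : 'I_(nb_vertices M),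
  vc i = carries M k x.
Proof. by move=> /(carries_vertex M1)[i iV E]; exists (Ordinal iV). Qed.

Lemma vertex_carriesI (i j : 'I_(nb_vertices M)) : vc i = vc j -> i = j.
Proof. by move=> E; apply/val_inj/(vertex_carries_inj (ltn_ord i) (ltn_ord j) E). Qed.

Lemma carry_graph_right_resolving : right_resolving G.
Proof.
move=> i j j' l; rewrite !(carry_graphE _ _ (erefl (vc i))).
by move=> /andP[_ /eqP <-] /andP[_ /eqP E]; exact: vertex_carriesI.
Qed.

(** This loop pads the coded list of edges, makes the Perron eigenvalue at least 1, and provides a
    block of every length. *)
Lemma carry_graph_loop : (v0, v0, ord0) \in G.
Proof.
rewrite (carry_graphE _ _ vertex_carries0) vertex_carries0; apply/andP; split.
  by apply/all_iotaP => i _; rewrite /carry !muln0 div0n.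
by apply/eqP/carries_eqP => i _; rewrite /carry muln0 !div0n.
Qed.

Lemma carry_graph_label (i j : 'I_(nb_vertices M)) (a : 'I_3) : (i, j, a) \in G -> a < 2.
Proof.
rewrite (carry_graphE _ _ (erefl (vc i))) => /andP[+ _].
apply: (digit_ok_lt2 M1) => //.
by apply: admissible_lt; apply: (vertexP (M := M)).
Qed.

Lemma carry_graph_reachable : all_reachable G v0.
Proof.
move=> i; have := vertexP (ltn_ord i).
suff H k x : admissible M k x -> forall i : 'I__, vc i = carries M k x ->
    connect (fun j k => [exists l, (j, k, l) \in G]) v0 i.
  by move/H; apply.
elim/admissible_ind: k x / => [j Ej|k x a a3 xP ok IH j Ej].
  by rewrite (@vertex_carriesI v0 j)// vertex_carries0 Ej.
have [l lE] := carries_vertexI xP.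
apply: connect_trans (IH _ lE) (connect1 _); apply/existsP.
by exists (Ordinal a3); rewrite (carry_graphE _ _ lE) ok Ej /=.
Qed.

Lemma vertex_origin_encodes : encodes_graph G v0 (graph_code M).
Proof.
(* [triple] is the counterpart of [edge_list_code] with typed vertices: the number [e] is read in
   mixed radix as (i n + j) 3 + a. *)
pose n := nb_vertices M; pose triple e : 'I_n * 'I_n * 'I_3 :=
  let t := (insubd v0 (e %/ 3 %/ n), insubd v0 (e %/ 3 %% n), inord (e %% 3)) in
  if t \in G then t else (v0, v0, ord0).
have tripleP e : triple e \in G.
  by rewrite /triple; case: ifP => // _; exact: carry_graph_loop.
exists (rev (mkseq triple (n * n * 3))).
  move=> [[i j] a]; rewrite mem_rev; apply/mapP/idP => [[e _ ->]//|ijaG].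
  exists ((i * n + j) * 3 + a).
    rewrite mem_iota add0n /=.
    by have := ltn_ord i; have := ltn_ord j; have := ltn_ord a; rewrite -/n; nia.
  have jn : j < n := ltn_ord j; have n0 : 0 < n by exact: leq_ltn_trans jn.
  rewrite /triple divnMDl// (divn_small (ltn_ord a)) addn0 !modnMDl.
  rewrite (modn_small (ltn_ord a)) (modn_small jn) divnMDl// (divn_small jn) addn0.
  by rewrite !valKd inord_val ijaG.
rewrite /graph_code !CodeSeq.codeK; congr code; congr [:: _, _ & _].
rewrite map_rev /mkseq -map_comp; congr rev; apply/eq_in_map => e.
rewrite mem_iota add0n /= => e_lt.
have n0 : 0 < n := nb_vertices_gt0 M1.
have e3 : e %/ 3 < n * n by rewrite ltn_divLR.
have val_insubd m : m < n -> val (insubd v0 m) = m by move=> mn; rewrite val_insubd mn.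
have [q_lt r_lt] : e %/ 3 %/ n < n /\ e %/ 3 %% n < n by rewrite ltn_divLR ?ltn_pmod.
rewrite /edge_list_code -/n !CodeSeq.codeK /triple inE /=.
rewrite !val_insubd// inordK ?ltn_pmod//.
by case: ifP => //= _; rewrite /edge_code /= !val_insubd// inordK ?ltn_pmod.
Qed.

End Graph.

(** * Digits of 3-adic integers and intersections of Cantor sets *)

Lemma Z3_digitsS a k : Z3_digits a k.+1 = Z3_digits a k + a k * 3 ^ k.
Proof.
suff sum_lt n : \sum_(j < n) a j * 3 ^ j < 3 ^ n.
  have E n : Z3_digits a n = \sum_(j < n) a j * 3 ^ j :> nat.
    by rewrite [LHS]modn_small.
  by rewrite !E big_ord_recr.
elim: n => [|n IH]; first by rewrite big_ord0.
rewrite big_ord_recr expnS /= (@leq_trans (3 ^ n + a n * 3 ^ n)) ?ltn_add2r//.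
by rewrite -mulSn leq_pmul2r ?expn_gt0.
Qed.

Lemma Z3_digits0 a : Z3_digits a 0 = 0.
Proof. by rewrite /= big_ord0. Qed.

Lemma Z3_digitK a k : Z3_digits a k.+1 %/ 3 ^ k = a k.
Proof. by rewrite Z3_digitsS addnC divnMDl ?expn_gt0// divn_small ?addn0// res_lt. Qed.

Lemma Sigma3P z : Sigma3 z <-> forall k, z k.+1 %/ 3 ^ k < 2.
Proof.
split => [[a a2 <-] k|z2]; first by rewrite Z3_digitK.
pose a : symbols := fun k => inord (z k.+1 %/ 3 ^ k).
have aE k : a k = z k.+1 %/ 3 ^ k :> nat by rewrite inordK// (leq_trans (z2 k)).
exists a; first by move=> k /=; rewrite aE.
apply: Z3_ext; elim=> [|k IH]; first by rewrite Z3_digits0 resP modn1.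
by rewrite Z3_digitsS IH aE [z k in LHS]resP addnC -divn_eq.
Qed.

Lemma Sigma3_mulP m z : Sigma3 (m%:R * z)%R <->
  forall k, (m * z k.+1 %/ 3 ^ k) %% 3 < 2.
Proof.
have E k : (m%:R * z)%R k.+1 %/ 3 ^ k = (m * z k.+1 %/ 3 ^ k) %% 3.
  by rewrite resM res_nat modnMml modn_divl -expnS.
by split=> [/Sigma3P + k|H]; [move=> /(_ k); rewrite E|apply/Sigma3P => k; rewrite E].
Qed.

(** The digit of index [j] of m z depends only on z modulo 3^(j+1), so it can be read on any residue
    of z modulo 3^k with k > j. *)
Lemma cantor_interP M z : cantor_inter M z <->
  forall k, admissible (1 :: M) k (z k).
Proof.
have digitE m j k : j < k -> (m * z k %/ 3 ^ j) %% 3 = (m * z j.+1 %/ 3 ^ j) %% 3.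
  by move=> jk; rewrite !modn_divl -expnS -modnMmr -res_le.
split=> [[z2 Mz2] k|zP].
  rewrite /admissible res_lt; apply/all_iotaP => i iM; apply/all_iotaP => j jk.
  rewrite digitE//; move: j {jk}; apply/Sigma3_mulP.
  have : nth 0 (1 :: M) i \in 1 :: M by exact: mem_nth.
  by rewrite inE => /predU1P[->|/Mz2//]; rewrite mul1r.
have H m : m \in 1 :: M -> Sigma3 (m%:R * z)%R.
  move=> mM; apply/Sigma3_mulP => k.
  have /andP[_ /all_iotaP/(_ (index m (1 :: M)))] := zP k.+1.
  by rewrite index_mem nth_index// => /(_ mM)/all_iotaP; apply.
by split=> [|m mM]; [rewrite -[z]mul1r; apply: (H 1); rewrite inE eqxx|apply: H; rewrite inE mM orbT].
Qed.

(** The vertex reached after [k] steps is the one whose carries are those of the first [k] digits;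
    this determines the walk from the digits. *)
Lemma path_set_carry_graph M (M1 : 1 \in 1 :: M) :
  path_set (carry_graph (1 :: M)) (vertex_origin M1) =
    [set a | cantor_inter M (Z3_digits a)].
Proof.
apply/seteqP; split=> a.
  move=> [w [w0 wG]]; apply/cantor_interP => k.
  suff [] : admissible (1 :: M) k (Z3_digits a k) /\
    vertex_carries (1 :: M) (w k) = carries (1 :: M) k (Z3_digits a k) by [].
  elim: k => [|k [IHa IHc]].
    by rewrite Z3_digits0 w0 vertex_carries0; split=> //; exact: admissible0.
  have := wG k; rewrite (carry_graphE _ _ IHc) => /andP[ok /eqP ->].
  by rewrite Z3_digitsS admissibleS ?res_lt// IHa ok.
move=> /= /cantor_interP aP.
pose w k := sval (cid (carries_vertexI M1 (aP k))).
have wE k : vertex_carries (1 :: M) (w k) = carries (1 :: M) k (Z3_digits a k).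
  exact: svalP (cid (carries_vertexI M1 (aP k))).
exists w; split=> [|k].
  by apply: vertex_carriesI; rewrite wE vertex_carries0 Z3_digits0.
rewrite (carry_graphE _ _ (wE k)) wE -Z3_digitsS eqxx andbT.
by have := aP k.+1; rewrite Z3_digitsS admissibleS ?res_lt// => /andP[].
Qed.

Local Open Scope ring_scope.

(** * Perron eigenvalue of a nonnegative matrix *)

(** By induction on the size: dividing by X - a leaves either a root at least [a], to which
    induction applies, or none, and then [a] is the largest root. *)
Lemma max_root_ge (F : realFieldType) (p : {poly F}) (a : F) :
  p != 0 -> root p a ->
  exists b, [/\ a <= b, root p b & forall c, root p c -> c <= b].
Proof.
elim: {p}(size p) {-2}p (leqnn (size p)) a => [|n IH] p sp a p0 pa.
  by move: sp p0; rewrite leqn0 size_poly_eq0 => ->.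
have [q pE] := factor_theorem p a pa.
have q0 : q != 0 by apply: contraNneq p0 => q0; rewrite pE q0 mul0r.
have [[b [ab qb]]|noroot] := pselect (exists b, a <= b /\ root q b).
  have [|c [bc qc cmax]] := IH q _ b q0 qb.
    by move: sp; rewrite pE size_Mmonic ?monicXsubC// size_XsubC addn2.
  exists c; split; [exact: le_trans bc | by rewrite pE rootM qc |].
  move=> d; rewrite pE rootM root_XsubC => /orP[/cmax//|/eqP ->].
  exact: le_trans bc.
exists a; split=> // c; rewrite pE rootM root_XsubC => /orP[qc|/eqP->//].
by rewrite leNgt; apply/negP => ac; apply: noroot; exists c; rewrite ltW.
Qed.

Section Perron.
Variables (R : realType) (n : nat).
Variable A : 'M[R]_n.
Hypothesis A0 : forall i j, 0 <= A i j.

Let D := char_poly A.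
(** By Cramer's rule P(t) / D(t) solves t x = A x + 1 wherever D(t) is nonzero. *)
Let P := \adj (char_poly_mx A) *m const_mx 1 : 'cV[{poly R}]_n.

Let horner_P (t : R) i :
  t * (P i 0).[t] = \sum_j A i j * (P j 0).[t] + D.[t].
Proof.
have /matrixP /(_ i 0) : char_poly_mx A *m P = D *: const_mx 1.
  by rewrite /P mulmxA mul_mx_adj mul_scalar_mx.
rewrite /char_poly_mx mulmxBl mul_scalar_mx => /(congr1 (fun p : {poly R} => p.[t])).
rewrite !mxE mulr1 !hornerE => /(canRL (subrK _)) ->.
rewrite addrC horner_sum; congr (_ + _); apply: eq_bigr => j _.
by rewrite !mxE !hornerE.
Qed.

Let P_gt0 (t : R) : 0 < t -> 0 < D.[t] -> (forall i, 0 <= (P i 0).[t]) ->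
  forall i, 0 < (P i 0).[t].
Proof.
move=> t0 Dt Pt i; rewrite -(pmulr_rgt0 _ t0) horner_P ltr_wpDl// sumr_ge0// => j _.
exact: mulr_ge0.
Qed.

(** Beyond all row sums, the equation at an index [i] where the entry is least gives (t - row sum)
    P_i(t) >= D(t) > 0. So the least entry is nonnegative, and [P_gt0] applies. *)
Let P_infty : exists T, forall t, T <= t -> 0 < D.[t] ->
  forall i, 0 < (P i 0).[t].
Proof.
exists (1 + \sum_i \sum_j A i j) => t Tt Dt.
have rowsum_ge0 i : 0 <= \sum_j A i j by apply: sumr_ge0.
have rowsum_lt i : \sum_j A i j < t.
  apply: lt_le_trans Tt; rewrite (@le_lt_trans _ _ (\sum_i \sum_j A i j)) ?ltrDr//.
  by rewrite [leRHS](bigD1 i)//= lerDl sumr_ge0.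
move=> i0; have t0 : 0 < t by exact: le_lt_trans (rowsum_lt i0).
apply: P_gt0 => // {}i0.
pose i := [arg min_(i < i0) (P i 0).[t]]%O.
have imin j : (P i 0).[t] <= (P j 0).[t].
  by rewrite /i; case: Order.TotalTheory.arg_minP => // k _; apply.
apply: le_trans (imin i0).
have : 0 <= (t - \sum_j A i j) * (P i 0).[t].
  rewrite mulrBl horner_P mulr_suml addrAC addr_ge0// ?(ltW Dt)//.
  by rewrite -sumrB sumr_ge0// => j _; rewrite -mulrBr mulr_ge0// subr_ge0.
by rewrite pmulr_rge0// subr_gt0.
Qed.

(* The adjugate provides a solution whose entries are rational functions of [t]:
   positive for [t] large, they cannot change sign before an eigenvalue, because
   a nonnegative solution is positive. *)
Lemma positive_resolvent (t : R) : 0 < t ->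
  (forall s, t <= s -> ~~ eigenvalue A s) ->
  exists2 x : 'I_n -> R, (forall i, 0 < x i) &
    forall i, t * x i = \sum_j A i j * x j + 1.
Proof.
move=> t0 noeig.
(* The characteristic polynomial is monic and has no root from [t] on. *)
have D0 s : t <= s -> 0 < D.[s].
  move=> ts; have Dmon : 0 < lead_coef D by rewrite (monicP (char_poly_monic A)).
  have [T DT] := poly_pinfty_gt_lc Dmon.
  have DT' : 0 < D.[Num.max s T].
    by apply: lt_le_trans Dmon (DT _ _); rewrite le_max lexx orbT.
  rewrite ltNge; apply/negP => Ds.
  have sT : s <= Num.max s T by rewrite le_max lexx.
  have [|u] := poly_ivt (p := D) sT; first by rewrite Ds ltW.
  move=> /andP[su _]; rewrite -eigenvalue_root_char; apply/negP.
  by apply: noeig; exact: le_trans su.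
suff Pt i : 0 < (P i 0).[t].
  exists (fun i => (P i 0).[t] / D.[t]) => i; first by rewrite divr_gt0// D0.
  rewrite mulrA horner_P mulrDl divff ?gt_eqF ?D0// mulr_suml.
  by congr (_ + _); apply: eq_bigr => j _; rewrite mulrA.
have [T PT] := P_infty.
pose q := \prod_i P i 0.
pose T' := Num.max t T.
have PT' s : T' <= s -> forall j, 0 < (P j 0).[s].
  rewrite ge_max => /andP[ts Ts]; exact: PT (D0 _ ts).
have q0 : q != 0.
  apply/prodf_neq0 => j _; apply/eqP => Pj.
  by have := PT' T' (lexx _) j; rewrite Pj horner0 ltxx.
have qroot s : root q s = [exists j, root (P j 0) s].
  rewrite /q rootE horner_prod; apply/idP/existsP => [/prodf_eq0[j _ js]|[j js]].
    by exists j.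
  by apply/prodf_eq0; exists j.
(* An entry negative at [s] would vanish further on, by the intermediate value theorem; all entries
   are thus nonnegative at [s], hence positive. *)
have pos s : t <= s -> (forall u, s < u -> ~~ root q u) -> forall j, 0 < (P j 0).[s].
  move=> ts nor; have s0 := lt_le_trans t0 ts.
  apply: P_gt0 => //; first exact: D0.
  move=> j; rewrite leNgt; apply/negP => Pjs.
  have sT : s <= Num.max s T' by rewrite le_max lexx.
  have [|u] := poly_ivtoo (p := P j 0) sT.
    by rewrite nmulr_rlt0//; apply: PT'; rewrite le_max lexx orbT.
  rewrite in_itv /= => /andP[su _] ju; have := nor u su.
  by rewrite qroot => /existsPn/(_ j); rewrite ju.
(* If some entry vanished beyond [t], then at the largest such zero [pos] would make every entry
   positive. *)
move: i; apply: (pos t) => // u tu; apply/negP => qu.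
have [b [ub qb bmax]] := max_root_ge q0 qu.
have [j] : exists j, root (P j 0) b by apply/existsP; rewrite -qroot.
have tb : t <= b by exact: le_trans (ltW tu) ub.
rewrite /root gt_eqF//; apply: (pos b) => // c bc; apply/negP => /bmax.
by rewrite leNgt bc.
Qed.

(** Without an eigenvalue at least 1, there would be a positive solution of x = A x + 1, and the
    diagonal entry would give x_i0 >= x_i0 + 1. *)
Lemma perron_exists i0 : 1 <= A i0 i0 ->
  exists b, 1 <= b /\ perron_eigenvalue A b.
Proof.
move=> Ai0; have [noeig|] := pselect (forall s, 1 <= s -> ~~ eigenvalue A s).
  have [x x0 /(_ i0)] := positive_resolvent ltr01 noeig.
  rewrite mul1r (bigD1 i0)//= => /eqP; rewrite lt_eqF//.
  rewrite -addrA (@lt_le_trans _ _ (x i0 + 1)) ?ltrDl//.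
  apply: lerD; first by rewrite ler_peMl// ltW.
  rewrite lerDr sumr_ge0// => j _.
  by rewrite mulr_ge0// ltW.
move/existsNP => [s /not_implyP[s1 /negP/negPn]].
rewrite eigenvalue_root_char => /max_root_ge[|b [sb rb bmax]].
  exact/monic_neq0/char_poly_monic.
exists b; split; first exact: le_trans sb.
by split=> [|a]; rewrite eigenvalue_root_char//; exact: bmax.
Qed.

Lemma subinvariant_vector b : 0 <= b -> eigenvalue A b ->
  exists y : 'I_n -> R, [/\ forall i, 0 <= y i, exists i, 0 < y i &
    forall i, b * y i <= \sum_j A i j * y j].
Proof.
move=> b0 /eigenvalueP[v vA v0].
(* [eigenvalue] provides a row vector; the determinant gives an eigenvector of the transpose, as
   needed for A y. *)
have : \det (A - b%:M) == 0.
  by apply/det0P; exists v => //; rewrite mulmxBr vA mul_mx_scalar subrr.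
rewrite -det_tr => /det0P[w w0]; rewrite linearB /= tr_scalar_mx mulmxBr mul_mx_scalar.
move/subr0_eq => wA; exists (fun i => `|w 0 i|); split=> [//||i].
  have [i wi] : exists i, w 0 i != 0.
    apply/existsP; apply: contra_neqT w0 => /existsPn w0.
    by apply/rowP => i; rewrite mxE; apply/eqP/negPn/w0.
  by exists i; rewrite normr_gt0.
have /rowP/(_ i) := wA; rewrite !mxE => wAi.
rewrite -[b in leLHS]ger0_norm// -normrM -wAi (le_trans (ler_norm_sum _ _ _))//.
by apply: ler_sum => j _; rewrite mxE normrM mulrC ger0_norm.
Qed.

(* [y + A y] is subinvariant when [y] is, with a larger support. *)
Lemma subinvariant_vector_root b v0 : 0 <= b -> eigenvalue A b ->
  (forall i, connect (fun j k => 0 < A j k) v0 i) ->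
  exists y : 'I_n -> R, [/\ forall i, 0 <= y i, 0 < y v0 &
    forall i, b * y i <= \sum_j A i j * y j].
Proof.
move=> b0 /(subinvariant_vector b0)[y [y0 [i yi] yb]] /(_ i)/connectP[p].
elim: p v0 => [|k p IH] v0 /=; first by move=> _ iv; exists y; rewrite -iv.
move=> /andP[Avk /IH{}IH] /IH[z [z0 zk zb]].
exists (fun i => z i + \sum_j A i j * z j); split=> [j||j].
- by rewrite addr_ge0// sumr_ge0// => l _; rewrite mulr_ge0.
- rewrite ltr_wpDl// (bigD1 k)//= ltr_pwDl ?mulr_gt0// sumr_ge0// => l _.
  by rewrite mulr_ge0.
rewrite mulrDr; under [leRHS]eq_bigr do rewrite mulrDr.
rewrite big_split lerD//= mulr_sumr; apply: ler_sum => l _.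
by rewrite mulrCA ler_wpM2l.
Qed.

End Perron.

(** * Counting walks *)

Section Adjacency.
Variables (R : realType) (n : nat) (G : lgraph n).
Local Notation A := (adjacency G R).

Lemma adjacency_ge0 i j : 0 <= A i j.
Proof. by rewrite mxE. Qed.

Lemma adjacency_mul i (y : 'I_n -> R) :
  \sum_j A i j * y j = \sum_(e : 'I_n * 'I_3 | (i, e.1, e.2) \in G) y e.1.
Proof.
rewrite -(pair_big_dep xpredT (fun j l => (i, j, l) \in G) (fun j _ => y j)) /=.
by apply: eq_bigr => j _; rewrite sumr_const mxE mulr_natl.
Qed.

Lemma adjacency_connect v0 i : all_reachable G v0 ->
  connect (fun j k => 0 < A j k) v0 i.
Proof.
move=> /(_ i); apply: connect_sub => j k /existsP[l jkl].
by apply: connect1; rewrite mxE ltr0n; apply/card_gt0P; exists l.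
Qed.

Fixpoint walks k i : seq (seq 'I_3) :=
  if k is k'.+1 then
    [seq e.2 :: w | e : 'I_n * 'I_3 <- enum [pred e | (i, e.1, e.2) \in G],
                    w <- walks k' e.1]
  else [:: [::]].

(** The vector t x is at least 1 everywhere, and A x <= t x: lengthening the walks by one edge costs
    at most a factor [t]. *)
Lemma size_walks (x : 'I_n -> R) (t : R) : 0 <= t -> (forall i, 0 <= x i) ->
  (forall i, t * x i = \sum_j A i j * x j + 1) ->
  forall k i, (size (walks k i))%:R <= t ^+ k.+1 * x i.
Proof.
move=> t0 x0 tx; elim=> [|k IH] i.
  by rewrite expr1 tx lerDr sumr_ge0// => j _; rewrite mulr_ge0 ?adjacency_ge0.
rewrite exprSr -mulrA tx mulrDr mulr1 ler_wpDr ?exprn_ge0// adjacency_mul.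
rewrite size_allpairs_dep sumnE big_map big_enum natr_sum mulr_sumr.
exact: ler_sum.
Qed.

Lemma mem_walks (w : nat -> 'I_n) (x : symbols) :
  (forall k, (w k, w k.+1, x k) \in G) ->
  forall k m, mkseq (fun i => x (m + i)%N) k \in walks k (w m).
Proof.
move=> wG; elim=> [|k IH] m; first by rewrite inE.
apply/allpairsPdep; exists (w m.+1, x m), (mkseq (fun i => x (m.+1 + i)%N) k).
split; [by rewrite mem_enum inE /= wG | exact: IH | ].
rewrite /mkseq /= addn0 (iotaDl 1 0) -map_comp; congr cons.
by apply: eq_map => i /=; rewrite addnA addn1.
Qed.

(** A block at position [m] is read from the vertex reached at time [m], whence the sum over all
    starting vertices. *)
Lemma nb_blocks_walks v k :
  (nb_blocks (path_set G v) k <= \sum_i size (walks k i))%N.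
Proof.
rewrite /nb_blocks cardE -(size_map val).
apply: (@leq_trans (size [seq w | i <- enum 'I_n, w <- walks k i])).
  apply: uniq_leq_size; first by rewrite (map_inj_uniq val_inj) enum_uniq.
  move=> _ /mapP[b bP ->]; move: bP; rewrite mem_enum unfold_in /=.
  move=> /asboolP[x [m [[w [_ wG]] bx]]].
  apply/allpairsPdep; exists (w m), (val b); split; rewrite ?mem_enum//.
  rewrite [val b](_ : _ = mkseq (fun i => x (m + i)%N) k); first exact: mem_walks.
  apply: (@eq_from_nth _ ord0); rewrite size_tuple ?size_mkseq// => i ik.
  by rewrite nth_mkseq// -(bx (Ordinal ik)) (tnth_nth ord0).
by rewrite size_allpairs_dep sumnE big_map big_enum.
Qed.

Lemma nb_blocks_le v (t : R) : 0 < t -> (forall s, t <= s -> ~~ eigenvalue A s) ->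
  exists2 C : R, 0 < C & forall k, (nb_blocks (path_set G v) k)%:R <= C * t ^+ k.
Proof.
move=> t0 /(positive_resolvent adjacency_ge0 t0)[x x0 tx].
exists (t * \sum_i x i).
  by rewrite mulr_gt0// (bigD1 v)//= ltr_pwDl// sumr_ge0// => j _; exact: ltW.
move=> k; apply: le_trans (_ : (\sum_i size (walks k i))%:R <= _).
  by rewrite ler_nat; exact: nb_blocks_walks.
rewrite natr_sum mulrAC -exprS mulr_sumr; apply: ler_sum => i _.
by apply: size_walks => // [|j]; exact: ltW.
Qed.

Hypotheses (Gres : right_resolving G)
  (G2 : forall i j a, (i, j, a) \in G -> (a < 2)%N).

(** At the largest entry y_i of a subinvariant vector, b y_i is at most y_i times the number of
    edges leaving [i]. These have distinct labels in {0, 1}. *)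
Lemma eigenvalue_adjacency_le2 (b : R) : eigenvalue A b -> b <= 2.
Proof.
have [b0|/ltW b0 _] := leP 0 b; last by rewrite (le_trans b0).
move=> /(subinvariant_vector adjacency_ge0 b0)[y [y0 [k yk] yb]].
pose i := [arg max_(i > k) y i]%O.
have imax j : y j <= y i.
  by rewrite /i; case: Order.TotalTheory.arg_maxP => // l _; apply.
have yi : 0 < y i by exact: lt_le_trans (imax k).
rewrite -(ler_pM2r yi) (le_trans (yb i))// adjacency_mul.
apply: (@le_trans _ _ (\sum_(e : 'I_n * 'I_3 | (i, e.1, e.2) \in G) y i)).
  exact: ler_sum.
rewrite sumr_const -[leLHS]mulr_natl ler_wpM2r ?(ltW yi)// ler_nat.
set Q := [pred e : 'I_n * 'I_3 | (i, e.1, e.2) \in G].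
have inj : {in Q &, injective snd}.
  move=> [j a] [j' a'] /=; rewrite !inE /= => + + aa'; rewrite -aa' => h h'.
  by rewrite (Gres h h').
rewrite -(card_in_image inj) (@leq_trans #|[pred a : 'I_3 | a < 2]|)%N//.
  apply: subset_leq_card; apply/fintype.subsetP => _ /mapP[e + ->].
  by rewrite mem_enum !inE => /G2.
by rewrite -sum1_card big_mkcond !big_ord_recl big_ord0.
Qed.

End Adjacency.

(** * Hausdorff dimension *)

Lemma Z3_digits_prefix (a b : symbols) k :
  (forall j, (j < k)%N -> a j = b j) -> Z3_digits a k = Z3_digits b k.
Proof.
elim: k => [|k IH] ab; first by rewrite !Z3_digits0.
by rewrite !Z3_digitsS IH ?ab// => j jk; rewrite ab// ltnW.
Qed.

Section Hausdorff.
Variable R : realType.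
Local Notation T := (Z3_metric R).

Lemma mdist_Z3 (x y : T) k : (mdist x y <= 3 ^- k) = ((x : Z3) k == (y : Z3) k).
Proof.
rewrite [mdist x y]/(Z3_norm R _) Z3_norm_le resD resN modnDmr.
have xk := res_lt x k; have yk := res_lt y k.
have -> : ((x : Z3) k + (3 ^ k - (y : Z3) k) = 3 ^ k + (x : Z3) k - (y : Z3) k)%N by lia.
apply/eqP/eqP => [|->]; last by rewrite addnK modnn.
have [xy|xy] := leqP ((y : Z3) k) ((x : Z3) k); last by rewrite modn_small; lia.
by rewrite -addnBA// modnDl modn_small; lia.
Qed.

Lemma diam_ge0 (U : set T) : (0 <= diam U)%E.
Proof. by rewrite /diam le_max lexx. Qed.

Lemma diam_set0 : diam (set0 : set T) = 0%E.
Proof. by rewrite /diam setX0 image_set0 ereal_sup0 max_l// leNye. Qed.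

Lemma diam_le (U : set T) k : (forall x y : T, U x -> U y -> (x : Z3) k = (y : Z3) k) ->
  (diam U <= (3 ^- k)%:E)%E.
Proof.
move=> Uk; rewrite /diam ge_max lee_fin invr_ge0 exprn_ge0//=.
apply/ereal_supP => _ [[x y] /= [Ux Uy] <-].
by rewrite lee_fin mdist_Z3; apply/eqP/Uk.
Qed.

Lemma le_diam (U : set T) (x y : T) : U x -> U y -> ((mdist x y)%:E <= diam U)%E.
Proof.
move=> Ux Uy; rewrite /diam le_max; apply/orP; right; apply: ereal_sup_ubound.
by exists (x, y).
Qed.

Lemma premeasure_ge0 s d (C : set T) : (0 <= hausdorff_premeasure s d C)%E.
Proof.
apply/ereal_infP => _ [U _ <-]; apply: nneseries_ge0 => i _ _.
exact: poweR_ge0.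
Qed.

Lemma premeasure_le_measure s d (C : set T) : 0 < d ->
  (hausdorff_premeasure s d C <= hausdorff_measure s C)%E.
Proof. by move=> d0; apply: ereal_sup_ubound; exists d. Qed.

Lemma powR3_inv s k : ((3 ^- k) `^ s = (3 `^ s) ^- k :> R).
Proof.
rewrite -powR_mulrn ?powR_ge0// -powRrM -powR_invn// -!powRrM -powRN.
by rewrite mulNr mulrC.
Qed.

Lemma exists_expr_lt (q e : R) : 0 <= q -> q < 1 -> 0 < e ->
  exists K, forall k, (K <= k)%N -> q ^+ k < e.
Proof.
move=> q0 q1 e0; have /cvg_expr /cvgrPdist_lt/(_ e e0) : `|q| < 1 by rewrite ger0_norm.
case=> K _ HK; exists K => k /HK /=.
by rewrite sub0r normrN ger0_norm// exprn_ge0.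
Qed.

(** The cylinders of the blocks of length [k] have diameter at most 3^-k, and their total cost is at
    most C (t / 3^s)^k, which is small for large [k]. Bounds for arbitrarily large lengths
    suffice. *)
Lemma hausdorff_measure_eq0 (X : set symbols) (s t C : R) :
  0 < s -> 0 < t -> t < 3 `^ s -> 0 < C ->
  (forall K, exists2 k, (K <= k)%N & (nb_blocks X k)%:R <= C * t ^+ k) ->
  hausdorff_measure s ([set Z3_digits a | a in X] : set T) = 0%E.
Proof.
move=> s0 t0 ts C0 XC; set E := (X in hausdorff_measure s X).
apply/eqP; rewrite eq_le; apply/andP; split; last first.
  exact: le_trans (premeasure_ge0 s 1 E) (premeasure_le_measure _ _ ltr01).
apply/ereal_supP => _ [d /= d0 <-]; apply/lee_addgt0Pr => e e0; rewrite add0e.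
have p0 : 0 < 3 `^ s :> R by rewrite powR_gt0.
have q1 : t / 3 `^ s < 1 by rewrite ltr_pdivrMr// mul1r.
have [K1 HK1] := exists_expr_lt (ltW (divr_gt0 t0 p0)) q1 (divr_gt0 e0 C0).
have third : 3^-1 < 1 :> R by rewrite invf_lt1// ltr1n.
have third0 : 0 <= 3^-1 :> R by rewrite invr_ge0.
have [K2 HK2] := exists_expr_lt third0 third d0.
have [k] := XC (maxn K1 K2); rewrite geq_max => /andP[/HK1 kK1 /HK2 kK2] Nk.
rewrite exprVn in kK2.
pose P := [pred w : k.-tuple 'I_3 | `[< exists x m, X x /\
  forall i : 'I_k, tnth w i = x (m + i)%N >]].
pose w i := nth [tuple of nseq k ord0] (enum P) i.
(* The finite cover is completed by empty sets, of cost 0 because [s] is positive. *)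
pose U (i : nat) : set T := if (i < #|P|)%N then
  [set z | exists2 a : symbols, Z3_digits a = z & forall j : 'I_k, a j = tnth (w i) j]
  else set0.
have Uk i : (diam (U i) <= (3 ^- k)%:E)%E.
  apply: diam_le => x y; rewrite /U; case: ifP => // _ [a <- aw] [b <- bw].
  by apply: Z3_digits_prefix => j jk; rewrite (aw (Ordinal jk)) (bw (Ordinal jk)).
apply: ge_ereal_inf; exists (\sum_(0 <= i <oo) poweR (diam (U i)) s)%E.
  exists U => //; split=> [z [a Xa <-]|i]; last first.
    by rewrite (le_trans (Uk i))// lee_fin ltW.
  pose v := [tuple a i | i < k].
  have vP : v \in P by apply/asboolP; exists a, 0%N; split=> // i; rewrite tnth_mktuple.
  exists (index v (enum P)) => //.
  rewrite /U ifT; last by rewrite cardE index_mem mem_enum.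
  by exists a => // j; rewrite /w nth_index ?mem_enum// tnth_mktuple.
have Us i : (poweR (diam (U i)) s <= ((3 `^ s) ^- k)%:E)%E.
  rewrite -powR3_inv -poweR_EFin; apply: gt0_ler_poweR; rewrite ?(ltW s0)//.
    by rewrite in_itv /= diam_ge0 leey.
  by rewrite in_itv /= lee_fin invr_ge0 exprn_ge0// leey.
rewrite (nneseries_split 0 #|P|); last by move=> *; exact: poweR_ge0.
rewrite eseries0; last first.
  by move=> i; rewrite add0n => Pi _; rewrite /U ltnNge Pi /= diam_set0 poweR0r// gt_eqF.
rewrite adde0 add0n (le_trans (lee_sum _ (fun i _ => Us i)))//.
rewrite sumEFin lee_fin big_const_nat subn0 iter_addr_0 -[leLHS]mulr_natl.
apply: (@le_trans _ _ (C * t ^+ k * (3 `^ s) ^- k)).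
  by apply: ler_wpM2r Nk; rewrite invr_ge0 exprn_ge0// ltW.
rewrite -mulrA -expr_div_n mulrC -ler_pdivlMr//; exact: ltW.
Qed.

End Hausdorff.

(** * Lower bound for the dimension: a point that escapes a cheap cover *)

Section MassDistribution.
Variables (R : realType) (n : nat) (G : lgraph n) (v0 : 'I_n).
Hypothesis Gres : right_resolving G.
Variables (b : R) (y : 'I_n -> R).
Hypotheses (b0 : 0 < b) (y0 : forall i, 0 <= y i).
Hypothesis yb : forall i,
  b * y i <= \sum_(e : 'I_n * 'I_3 | (i, e.1, e.2) \in G) y e.1.

(* [F k r] is the cost of covering the cylinder of the residue [r] modulo [3 ^ k];
   as long as it is less than [y i / b ^ k], so it is for one of the successors. *)
Lemma light_path (F : nat -> nat -> \bar R) :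
  (forall k r, 0 <= F k r)%E ->
  (forall k r, (r < 3 ^ k)%N -> (\sum_(a < 3) F k.+1 (r + a * 3 ^ k)%N <= F k r)%E) ->
  (F 0%N 0%N < (y v0)%:E)%E ->
  exists2 x, path_set G v0 x &
    forall k, exists i, (F k (Z3_digits x k) < (y i / b ^+ k)%:E)%E.
Proof.
move=> F0 FS Fv0.
pose light k r i := (F k r < (y i / b ^+ k)%:E)%E.
pose good k r i (e : 'I_n * 'I_3) :=
  ((i, e.1, e.2) \in G) && `[< light k.+1 (r + e.2 * 3 ^ k)%N e.1 >].
have step k r i : (r < 3 ^ k)%N -> light k r i -> exists e, good k r i e.
  move=> rk lkri; apply: contrapT => /forallNP none.
  have heavy e : (i, e.1, e.2) \in G ->
      ((y e.1 / b ^+ k.+1)%:E <= F k.+1 (r + e.2 * 3 ^ k)%N)%E.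
    by move=> ie; rewrite leNgt; apply/negP => le; apply: (none e); rewrite /good ie; apply/asboolP.
  (* If every successor were heavy, summing over the edges that leave [i] would make the current
     cylinder heavy too. *)
  have : ((y i / b ^+ k)%:E <= \sum_(a < 3) F k.+1 (r + a * 3 ^ k)%N)%E.
    apply: (@le_trans _ _
        (\sum_(e : 'I_n * 'I_3 | (i, e.1, e.2) \in G) (y e.1 / b ^+ k.+1)%:E)%E).
      rewrite sumEFin lee_fin -mulr_suml exprS invfM mulrA ler_wpM2r//.
        by rewrite invr_ge0 exprn_ge0// ltW.
      by rewrite ler_pdivlMr// mulrC.
    apply: (@le_trans _ _ (\sum_(e : 'I_n * 'I_3 | (i, e.1, e.2) \in G)
        F k.+1 (r + e.2 * 3 ^ k)%N)%E).
      by apply: lee_sum => e; exact: heavy.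
    rewrite (partition_big snd xpredT)//=; apply: lee_sum => a _.
    (* Since the graph is right-resolving, a digit [a] belongs to at most one edge from [i], and no
       cylinder is counted twice. *)
    have [[j jG]|nojG] := pselect (exists j, (i, j, a) \in G); last first.
      by rewrite big1// => -[j l] /andP[/= ij /eqP la]; case: nojG; exists j; rewrite -la.
    rewrite (big_pred1 (j, a))// => -[j' l]; rewrite /= xpair_eqE.
    apply/andP/andP => -[]; last by move=> /eqP -> /eqP ->; split.
    by move=> + /eqP la; rewrite la => /Gres/(_ jG) ->; split.
  by move=> /le_trans/(_ (FS _ _ rk)); rewrite leNgt -/(light k r i) lkri.
pose next k (ri : nat * 'I_n) := odflt (v0, ord0) [pick e | good k ri.1 ri.2 e].
(* The state consists of the residue formed by the first [k] digits and of the vertex reached. *)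
pose st := fix st k : nat * 'I_n := if k is k'.+1 then
  ((st k').1 + (next k' (st k')).2 * 3 ^ k', (next k' (st k')).1)%N else (0%N, v0).
pose x k := (next k (st k)).2.
have stx k : (st k).1 = Z3_digits x k.
  by elim: k => [|k IH]; rewrite ?Z3_digits0// Z3_digitsS -IH.
have st_light k : light k (st k).1 (st k).2 /\ good k (st k).1 (st k).2 (next k (st k)).
  have goodP m : light m (st m).1 (st m).2 -> good m (st m).1 (st m).2 (next m (st m)).
    move=> lm; rewrite /next; case: pickP => //= none.
    have [|e] := @step m (st m).1 (st m).2 _ lm; first by rewrite stx res_lt.
    by rewrite none.
  elim: k => [|k [_ /andP[_ /asboolP lk]]]; last by split=> //; exact: goodP.
  have l0 : light 0 (st 0).1 (st 0).2 by rewrite /light /= expr0 divr1.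
  by split=> //; exact: goodP.
exists x => [|k]; last by exists (st k).2; rewrite -stx; exact: (st_light k).1.
exists (fun k => (st k).2); split=> // k.
by have [_ /andP[]] := st_light k.
Qed.

Local Notation T := (Z3_metric R).
Local Notation E := ([set Z3_digits a | a in path_set G v0] : set T).

(** The exponent [m] is the largest with diam U <= 3^-m, so that 3^-(m+1) < diam U; this costs the
    factor 3^s. When the diameter is 0 or too small, a fixed [m] with 3^(-s m) < e is taken, whence
    the term [e]. *)
Lemma cylinder_radius (U : set T) (p : T) (s e : R) : 0 < s -> 0 < e -> U p ->
  (diam U <= 1)%E -> exists m, (forall z : T, U z -> (z : Z3) m = (p : Z3) m) /\
    (((3 `^ s) ^- m)%:E <= (3 `^ s)%:E * poweR (diam U) s + e%:E)%E.
Proof.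
move=> s0 e0 Up U1.
have dfin : diam U \is a fin_num.
  by rewrite ge0_fin_numE ?diam_ge0// (le_lt_trans U1)// ltry.
set d := fine (diam U).
have dE : diam U = d%:E by rewrite fineK.
have d0 : 0 <= d by rewrite fine_ge0// diam_ge0.
have d1 : d <= 1 by rewrite -lee_fin -dE.
have p1 : 1 < 3 `^ s :> R.
  by rewrite /powR gt_eqF// expR_gt1 mulr_gt0// ln_gt0// ltr1n.
have p0 : 0 < 3 `^ s :> R by exact: lt_trans p1.
have Um m : d <= 3 ^- m -> forall z : T, U z -> (z : Z3) m = (p : Z3) m.
  move=> dm z Uz; apply/eqP; rewrite -(@mdist_Z3 R) -lee_fin.
  by rewrite (le_trans (le_diam Uz Up))// dE lee_fin.
have [K HK] : exists K, forall k, (K <= k)%N -> (3 `^ s)^-1 ^+ k < e.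
  by apply: exists_expr_lt => //; rewrite ?invr_ge0 ?(ltW p0)// invf_lt1.
have [dK|Kd] := leP d (3 ^- K).
  exists K; split; first exact: Um.
  apply: (@le_trans _ _ e%:E); first by rewrite lee_fin -exprVn ltW// HK.
  by rewrite leeDr// mule_ge0 ?poweR_ge0 ?lee_fin ?(ltW p0).
have exd : exists k, (3 ^- k : R) < d by exists K.
case: (ex_minnP exd) => -[|m] md minm; first by move: md; rewrite expr0 invr1 ltNge d1.
exists m; split.
  by apply: Um; rewrite leNgt; apply/negP => /minm; rewrite ltnn.
rewrite dE poweR_EFin -EFinM -EFinD lee_fin ler_wpDr ?(ltW e0)//.
have -> : (3 `^ s) ^- m = 3 `^ s * (3 ^- m.+1) `^ s.
  by rewrite powR3_inv exprS invfM mulrA divff ?mul1r// gt_eqF.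
rewrite ler_wpM2l ?(ltW p0)// ge0_ler_powR ?nnegrE ?(ltW s0)// ?(ltW md)//.
Qed.

Lemma hausdorff_measure_neq0 (s : R) : 0 < y v0 -> 0 < s -> 3 `^ s < b ->
  hausdorff_measure s E != 0%E.
Proof.
move=> yv0 s0 sb; apply/eqP => E0.
have p0 : 0 < 3 `^ s :> R by rewrite powR_gt0.
pose Y := \sum_i y i.
have yY i : y i <= Y by rewrite /Y (bigD1 i)//= lerDl sumr_ge0.
have Y0 : 0 < Y by exact: lt_le_trans (yY v0).
(* The diameters contribute at most [c] and the errors c / 2^(i+1) sum to [c]: the total cost is at
   most 2 c Y, two thirds of [y v0]. *)
pose c : R := y v0 / Y / 3.
have c0 : 0 < c by rewrite !divr_gt0.
have : (hausdorff_premeasure s 1 E < (c / 3 `^ s)%:E)%E.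
  by rewrite (le_lt_trans (premeasure_le_measure s _ ltr01))// E0 lte_fin divr_gt0.
move=> /ereal_inf_lt[_ [U [EU U1] <-]] sumU.
have /choice[q qP] : forall i, exists q : option (nat * T),
    match q with
    | Some (m, p) => (forall z : T, U i z -> (z : Z3) m = (p : Z3) m) /\
        (((3 `^ s) ^- m)%:E <=
           (3 `^ s)%:E * poweR (diam (U i)) s + (c / (2 ^ i.+1)%:R)%:E)%E
    | None => U i = set0
    end.
  move=> i; have [->|/set0P[p Up]] := eqVneq (U i) set0; first by exists None.
  have [|m mP] := @cylinder_radius (U i) p s (c / (2 ^ i.+1)%:R) s0 _ Up (U1 i).
    by rewrite divr_gt0// ltr0n expn_gt0.
  by exists (Some (m, p)).
(* The cost of [U i] is that of its enclosing cylinder, charged to each cylinder of length at most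
   [m] that contains it. *)
pose W i k r : \bar R := if q i is Some (m, p) then
  if (k <= m)%N && ((p : Z3) k == r) then (Y * (3 `^ s) ^- m)%:E else 0%E else 0%E.
have W0 i k r : (0 <= W i k r)%E.
  rewrite /W; case: (q i) => [[m p]|//]; case: ifP => // _.
  by rewrite lee_fin mulr_ge0 ?(ltW Y0)// invr_ge0 exprn_ge0// ltW.
pose F k r := (\sum_(0 <= i <oo) W i k r)%E.
have F0 k r : (0 <= F k r)%E by apply: nneseries_ge0.
have [||x Xx xF] := light_path F0.
- move=> k r rk; rewrite /F -nneseries_sum//; apply: lee_nneseries.
    by move=> i _ _; apply: sume_ge0.
  move=> i _; rewrite /W; case: (q i) => [[m p]|]; last by rewrite big1.
  have [km|mk] := ltnP k m; last first.
    rewrite big1//; case: ifP => // _.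
    by rewrite lee_fin mulr_ge0 ?(ltW Y0)// invr_ge0 exprn_ge0// ltW.
  rewrite (ltnW km) /=; set w := (_ * _)%:E.
  pose a0 : 'I_3 := inord ((p : Z3) k.+1 %/ 3 ^ k).
  have a0E : (p : Z3) k.+1 = ((p : Z3) k + a0 * 3 ^ k)%N.
    rewrite inordK ?ltn_divLR ?expn_gt0//; last by rewrite -expnS res_lt.
    by rewrite [(p : Z3) k]resP addnC -divn_eq.
  have eqE (a : 'I_3) : ((p : Z3) k.+1 == (r + a * 3 ^ k)%N) = ((p : Z3) k == r) && (a == a0).
    rewrite a0E; apply/eqP/andP => [E|[/eqP -> /eqP ->]//].
    have pr : (p : Z3) k = r.
      have := congr1 (modn^~ (3 ^ k)%N) E.
      by rewrite -modnDmr modnMl addn0 -[in RHS]modnDmr modnMl addn0 res_mod modn_small.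
    split; apply/eqP => //; apply/val_inj/eqP; move/eqP: E.
    by rewrite pr eqn_add2l eqn_pmul2r ?expn_gt0// eq_sym.
  under eq_bigr do rewrite eqE.
  by case: eqP => _ /=; [rewrite -big_mkcond big_pred1_eq | rewrite big1].
- have WY i : (W i 0%N 0%N <= Y%:E * ((3 `^ s)%:E * poweR (diam (U i)) s +
      (c / (2 ^ i.+1)%:R)%:E))%E.
    have := qP i; rewrite /W; case: (q i) => [[m p]|] => [[_ le]|_]; last first.
      rewrite mule_ge0 ?lee_fin ?(ltW Y0)// adde_ge0 ?mule_ge0 ?poweR_ge0 ?lee_fin ?(ltW p0)//.
      by rewrite divr_ge0 ?(ltW c0).
    by rewrite resP modn1 /= EFinM lee_wpmul2l// lee_fin ltW.
  apply: le_lt_trans (lee_nneseries _ (fun i _ => WY i)) _; first by move=> *; exact: W0.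
  rewrite nneseriesZl; last first.
    move=> i _; rewrite adde_ge0 ?mule_ge0 ?poweR_ge0 ?lee_fin ?(ltW p0)//.
    by rewrite divr_ge0 ?(ltW c0).
  apply: (@le_lt_trans _ _ (Y%:E * ((3 `^ s)%:E * (c / 3 `^ s)%:E + c%:E))%E).
    rewrite lee_wpmul2l ?lee_fin ?(ltW Y0)//.
    apply: le_trans (epsilon_trick xpredT _ (ltW c0)) _.
      by move=> i; rewrite mule_ge0 ?poweR_ge0 ?lee_fin ?(ltW p0).
    rewrite nneseriesZl; last by move=> *; exact: poweR_ge0.
    by rewrite leeD2r// lee_wpmul2l ?lee_fin ?(ltW p0)// ltW.
  rewrite -[((3 `^ s)%:E * _)%E]EFinM (mulrC _ (c / _)) divfK ?gt_eqF//.
  rewrite -EFinD -EFinM lte_fin /c.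
  have -> : Y * (y v0 / Y / 3 + y v0 / Y / 3) = y v0 * (2 / 3).
    by field; rewrite gt_eqF.
  by rewrite gtr_pMr// ltr_pdivrMr// mul1r ltr_nat.
have [i _ Ui] : (\bigcup_i U i) (Z3_digits x) by apply: EU; exists x.
(* The point lies in some [U i], so its cylinder of length [m] costs at least Y 3^(-s m). This is at
   least y_j / b^m for all j, against lightness. *)
have := qP i; case Eq: (q i) => [[m p]|]; last by move=> Ui0; rewrite Ui0 in Ui.
move=> [pU _]; have [j] := xF m; rewrite ltNge => /negP; apply.
apply: (@le_trans _ _ (W i m (Z3_digits x m))).
  rewrite /W Eq leqnn /= -(pU _ Ui) eqxx lee_fin ler_pM// ?invr_ge0 ?exprn_ge0 ?(ltW b0)//.
  by rewrite lef_pV2 ?posrE ?exprn_gt0// lerXn2r ?nnegrE ?ltW.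
rewrite /F (@nneseriesD1 _ (fun l => W l m (Z3_digits x m)) i xpredT)//.
by rewrite leeDl//; apply: nneseries_ge0.
Qed.
End MassDistribution.

(** * Entropy and dimension of the path set *)

Section Growth.
Variables (R : realType) (n : nat) (G : lgraph n) (v0 : 'I_n).
Hypotheses (Gres : right_resolving G) (reachG : all_reachable G v0)
  (G2 : forall i j a, (i, j, a) \in G -> (a < 2)%N)
  (loop : (v0, v0, ord0) \in G).

Local Notation A := (adjacency G R).
Local Notation X := (path_set G v0).
Local Notation E := ([set Z3_digits a | a in X] : set (Z3_metric R)).

Variable b : R.
Hypotheses (b1 : 1 <= b) (bP : perron_eigenvalue A b).

Lemma no_eigenvalue t : b < t -> forall s, t <= s -> ~~ eigenvalue A s.
Proof.
move=> bt s ts; apply/negP => /bP.2; apply/negP.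
by rewrite -ltNge (lt_le_trans bt).
Qed.

Lemma integral_eigenvalue_adjacency : integralOver (intr : int -> R) b.
Proof.
exists (char_poly (adjacency G int)); first exact: char_poly_monic.
rewrite map_char_poly (_ : map_mx _ _ = A) -?eigenvalue_root_char; first exact: bP.1.
by apply/matrixP => i j; rewrite !mxE natz.
Qed.

Let b0 : 0 < b. Proof. exact: lt_le_trans b1. Qed.
Let ln3 : 0 < ln 3 :> R. Proof. by rewrite ln_gt0// ltr1n. Qed.

Lemma nb_blocks_gt0 k : (0 < nb_blocks X k)%N.
Proof.
apply/card_gt0P; exists [tuple ord0 | i < k]; apply/asboolP.
exists (fun=> ord0), 0%N; split=> [|i]; last by rewrite tnth_mktuple.
by exists (fun=> v0).
Qed.

Lemma hausdorff_measure_gt_dim s : ln b / ln 3 < s -> hausdorff_measure s E = 0%E.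
Proof.
move=> bs; have s0 : 0 < s.
  by rewrite (le_lt_trans _ bs)// divr_ge0 ?(ltW ln3)// ln_ge0.
have b3 : b < 3 `^ s.
  rewrite -[ltLHS]lnK ?posrE// /powR gt_eqF// ltr_expR.
  by rewrite -ltr_pdivrMr.
have [t /andP[bt t3]] : exists t, b < t < 3 `^ s.
  by exists ((b + 3 `^ s) / 2); apply/andP; split; lra.
have t0 : 0 < t by exact: lt_trans bt.
have [C C0 NC] := nb_blocks_le v0 t0 (no_eigenvalue bt).
by apply: (hausdorff_measure_eq0 s0 t0 t3 C0) => K; exists K.
Qed.

Lemma hausdorff_measure_lt_dim s : 0 < s -> s < ln b / ln 3 ->
  hausdorff_measure s E != 0%E.
Proof.
move=> s0 sb.
have [y [y0 yv0 yb]] := subinvariant_vector_root (adjacency_ge0 R G) (ltW b0) bP.1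
  (fun i => adjacency_connect R i reachG).
apply: (hausdorff_measure_neq0 Gres b0 y0 _ yv0 s0).
  by move=> i; rewrite -adjacency_mul.
rewrite -[ltRHS]lnK ?posrE// /powR gt_eqF// ltr_expR.
by rewrite -ltr_pdivlMr.
Qed.

Lemma hausdorff_dim_path_set : hausdorff_dim E = (ln b / ln 3)%:E.
Proof.
apply/eqP; rewrite eq_le; apply/andP; split.
  apply/lee_addgt0Pr => e e0; rewrite -EFinD; apply: ereal_inf_lbound.
  exists (ln b / ln 3 + e) => //; split.
    by rewrite ltr_wpDl// divr_ge0 ?(ltW ln3)// ln_ge0.
  by apply: hausdorff_measure_gt_dim; rewrite ltrDl.
apply/ereal_infP => _ [s [s0 /eqP sE] <-]; rewrite lee_fin leNgt; apply/negP.
by move=> /(hausdorff_measure_lt_dim s0); rewrite sE.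
Qed.

Let u k : \bar R := ((k%:R^-1)%:E * lne (nb_blocks X k)%:R%:E)%E.

Let uE k : u k = (k%:R^-1 * ln (nb_blocks X k)%:R)%:E.
Proof. by rewrite /u lne_EFin// ltr0n nb_blocks_gt0. Qed.

(** The upper bound comes from counting walks. For the lower bound, an entropy below ln b would give
    covers making the measure vanish for some s < ln b / ln 3, against
    [hausdorff_measure_lt_dim]. *)
Lemma topological_entropy_path_set : topological_entropy R X = (ln b)%:E.
Proof.
apply/eqP; rewrite eq_le; apply/andP; split.
  apply/lee_addgt0Pr => e e0; rewrite -EFinD.
  pose t := expR (ln b + e / 2).
  have bt : b < t by rewrite -[ltLHS]lnK ?posrE// ltr_expR ltrDl divr_gt0.
  have [C C0 NC] := nb_blocks_le v0 (expR_gt0 _) (no_eigenvalue bt).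
  (* From [K] on, the constant contributes at most e / 2 to the growth rate. *)
  pose K := (Num.truncn (ln C / (e / 2))).+1.
  apply: ge_ereal_inf; exists (ereal_sup [set u k | k in [set k | (K <= k)%N]]).
    by exists [set k | (K <= k)%N] => //; exists K.
  apply/ereal_supP => _ [k /= Kk <-]; rewrite uE lee_fin.
  have k0 : 0 < k%:R :> R by rewrite ltr0n (leq_trans _ Kk).
  rewrite ler_pdivrMl//; apply: (@le_trans _ _ (ln (C * t ^+ k))).
    by rewrite ler_ln ?posrE ?NC ?ltr0n ?nb_blocks_gt0// mulr_gt0 ?exprn_gt0 ?expR_gt0.
  rewrite lnM ?posrE ?exprn_gt0 ?expR_gt0// lnXn ?expR_gt0// expRK -[X in _ + X]mulr_natl.
  have Ck : ln C <= k%:R * (e / 2).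
    rewrite -ler_pdivrMr ?divr_gt0// ltW// (lt_le_trans (truncnS_gt _))//.
    by rewrite ler_nat.
  rewrite (_ : k%:R * (ln b + e) = k%:R * (e / 2) + k%:R * (ln b + e / 2)).
    by rewrite lerD2r.
  by rewrite -mulrDr addrCA -(splitr e).
rewrite leNgt; apply/negP => /ereal_inf_lt[_ [V [K _ KV] <-]] Vb.
have uV k : V k -> (u k <= ereal_sup (u @` V))%E.
  by move=> Vk; apply: ereal_sup_ubound; exists k.
set h := ereal_sup _ in Vb uV.
have h0 : (0 <= h)%E.
  apply: le_trans (uV K (KV K (leqnn K))); rewrite uE lee_fin mulr_ge0//.
  by rewrite ln_ge0// ler1n nb_blocks_gt0.
have hE : h = (fine h)%:E by rewrite fineK// ge0_fin_numE// (lt_trans Vb)// ltry.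
rewrite hE lee_fin in h0; rewrite hE lte_fin in Vb.
(* With this choice s ln 3 lies midway between the bound [h] on the growth rates and ln b. *)
pose s := (fine h + ln b) / 2 / ln 3.
have /andP[hs sb] : fine h < (fine h + ln b) / 2 < ln b.
  by apply/andP; split; lra.
have s0 : 0 < s by rewrite divr_gt0// (le_lt_trans h0).
have := hausdorff_measure_lt_dim s0; rewrite ltr_pM2r ?invr_gt0// => /(_ sb)/eqP; apply.
apply: (@hausdorff_measure_eq0 _ _ _ (expR (fine h)) 1) => //; first exact: expR_gt0.
  by rewrite /powR gt_eqF// ltr_expR divfK// gt_eqF.
move=> K'; exists (maxn K' K).+1; first by rewrite leqW// leq_maxl.
set k := (maxn K' K).+1.
have /uV : V k by apply: KV; rewrite /= leqW// leq_maxr.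
rewrite uE hE lee_fin ler_pdivrMl ?ltr0n// => lnN.
rewrite mul1r -expRM_natl -[leLHS]lnK ?posrE ?ltr0n ?nb_blocks_gt0//.
by rewrite ler_expR.
Qed.

End Growth.

Theorem theorem1p6 :
  exists algorithm : recfun,
  forall M : seq nat, sorted ltn M -> all (leq 1) M ->
  exists (n : nat) (G : lgraph n) (v0 : 'I_n),
    [/\ exists2 c, rec_eval algorithm [:: CodeSeq.code M] c & encodes_graph G v0 c,
        path_set G v0 = [set a | cantor_inter M (Z3_digits a)],
        right_resolving G,
        all_reachable G v0
      & (n <= \prod_(m <- M) (1 + m %/ 2))%N]
    /\
    forall R : realType, exists beta : R,
      [/\ perron_eigenvalue (adjacency G R) beta,
          topological_entropy R (path_set G v0) = (ln beta)%:E,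
          integralOver (intr : int -> R) beta
        & 1 <= beta <= 2%:R]
      /\
      [/\ hausdorff_dim_Z3 R (cantor_inter M)
            = (ln beta / ln 3%:R)%:E,
          (0 <= hausdorff_dim_Z3 R (cantor_inter M))%E
        & (hausdorff_dim_Z3 R (cantor_inter M)
            <= (ln 2%:R / ln 3%:R)%:E)%E].
Proof.
have [algorithm algP] := computable_graph_code; exists algorithm => M _ _.
have M1 := mem_head 1%N M.
exists (nb_vertices (1%N :: M)), (carry_graph (1%N :: M)), (vertex_origin M1).
have pathE := path_set_carry_graph M1.
have Gres := @carry_graph_right_resolving (1%N :: M).
have Greach := carry_graph_reachable M1.
have G2 := carry_graph_label M1; have Gloop := carry_graph_loop M1.
split; first split=> //.
- exists (graph_code (1%N :: M)); last exact: vertex_origin_encodes.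
  by have := algP [:: CodeSeq.code M] erefl; rewrite [nth _ _ _]/= !CodeSeq.codeK.
- apply: (leq_trans (nb_vertices_leq M1)).
  rewrite /nb_carries -(big_nth 0%N xpredT (fun m => 1 + m %/ 2)%N) big_cons.
  by rewrite (_ : (1 + 1 %/ 2)%N = 1%N)// mul1n.
move=> R; set G := carry_graph _ in Gres Greach G2 Gloop *.
have [|b [b1 bP]] := perron_exists (adjacency_ge0 R G) (i0 := vertex_origin M1).
  by rewrite mxE ler1n; apply/card_gt0P; exists ord0.
have b2 := eigenvalue_adjacency_le2 Gres G2 bP.1.
(* Elements of the intersection lie in [Sigma3], hence are given by digits. *)
have cantorE : cantor_inter M = [set Z3_digits a | a in path_set G (vertex_origin M1)].
  rewrite pathE; apply/seteqP; split=> [z zM|_ [a aM <-]//].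
  by have [[a _ az] _] := zM; exists a => //=; rewrite az.
have dimE : hausdorff_dim_Z3 R (cantor_inter M) = (ln b / ln 3%:R)%:E.
  by rewrite cantorE; exact: hausdorff_dim_path_set.
have ln3 : 0 < ln 3 :> R by rewrite ln_gt0// ltr1n.
exists b; split; split=> //; rewrite ?b1 ?dimE ?lee_fin//.
- exact: topological_entropy_path_set.
- exact: integral_eigenvalue_adjacency bP.
- by rewrite divr_ge0 ?(ltW ln3)// ln_ge0.
- by rewrite ler_pM2r ?invr_gt0// ler_ln ?posrE// (lt_le_trans _ b1).
Qed.
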